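(* Let $G$ be a Lie group and let $H=H(g,\mu,\nu,\xi)$ be a smooth function on the trivialized bundle $T^*T^*G\simeq(G\circledS\mathfrak g^* )\circledS(\mathfrak g^*\times\mathfrak g)$. Hamilton's equation $i_{X_H}\Omega_{T^*T^*G}=-dH$ uniquely defines the Hamiltonian vector field $X_H$, which is the right invariant vector field generated by $$\Big(\frac{\delta H}{\delta\nu},\ \frac{\delta H}{\delta\xi},\ \mathrm{ad}^*_{\frac{\delta H}{\delta\mu}}\mu-T_e^*R_g\Big(\frac{\delta H}{\delta g}\Big),\ -\frac{\delta H}{\delta\mu}\Big)\in(\mathfrak g\circledS\mathfrak g^* )\circledS(\mathfrak g^*\times\mathfrak g).$$ At the point $(g,\mu,\nu,\xi)$, Hamilton's equations are $$\frac{dg}{dt}=T_eR_g\Big(\frac{\delta H}{\delta\nu}\Big),\qquad\frac{d\mu}{dt}=\frac{\delta H}{\delta\xi}+\mathrm{ad}^*_{\frac{\delta H}{\delta\nu}}\mu,$$ $$\frac{d\nu}{dt}=\mathrm{ad}^*_{\frac{\delta H}{\delta\mu}}\mu+\mathrm{ad}^*_{\frac{\delta H}{\delta\nu}}\nu-T_e^*R_g\Big(\frac{\delta H}{\delta g}\Big)-\mathrm{ad}^*_\xi\frac{\delta H}{\delta\xi},\qquad\frac{d\xi}{dt}=-\frac{\delta H}{\delta\mu}+\Big[\frac{\delta H}{\delta\nu},\xi\Big].$$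
   Context: $G$ is a (finite-dimensional) Lie group with identity $e$, $\mathfrak g=T_eG$, dual $\mathfrak g^*$. $R_g$ is right multiplication, $T_e^*R_g:T_g^*G\to\mathfrak g^*$ the dual of $T_eR_g$. $\mathrm{Ad}_g=T_e(h\mapsto ghg^{-1})$, $\mathrm{ad}_\xi\eta=[\xi,\eta]=\frac{d}{dt}|_{t=0}\mathrm{Ad}_{\exp t\xi}\eta$, $\langle\mathrm{Ad}^*_g\mu,\xi\rangle=\langle\mu,\mathrm{Ad}_{g^{-1}}\xi\rangle$, $\langle\mathrm{ad}^*_\xi\mu,\eta\rangle=-\langle\mu,[\xi,\eta]\rangle$. $T^*G$ is identified with $G\circledS\mathfrak g^*$ by $\alpha_g\mapsto(g,T_e^*R_g\alpha_g)$, with group law $(g,\mu)(h,\nu)=(gh,\mu+\mathrm{Ad}^*_g\nu)$. $T^*T^*G=T^*(G\circledS\mathfrak g^* )$ is identified with $G\times\mathfrak g^*\times\mathfrak g^*\times\mathfrak g$ by sending a covector $(\alpha_g,\alpha_\mu)\in T_g^*G\times\mathfrak g$ at $(g,\mu)$ to $(g,\mu,\nu,\xi)=(g,\mu,T_e^*R_g\alpha_g-\mathrm{ad}^*_{\alpha_\mu}\mu,\alpha_\mu)$; $\Omega_{T^*T^*G}$ is the canonical form $d\theta$ ($\theta$ the Liouville form) transported by this map. The group law on $T^*T^*G$ is $(g,\mu_1,\mu_2,\xi)(h,\nu_1,\nu_2,\eta)=(gh,\mu_1+\mathrm{Ad}_g^*\nu_1,\mu_2+\mathrm{Ad}_g^*\nu_2-\mathrm{ad}^*_{\mathrm{Ad}_g\eta}\mu_1,\xi+\mathrm{Ad}_g\eta)$,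 and the vector at $(g,\mu,\nu,\xi)$ of the right invariant vector field generated by $(\eta_1,\nu_1,\nu_2,\eta_2)$ is $(T_eR_g\eta_1,\ \nu_1+\mathrm{ad}^*_{\eta_1}\mu,\ \nu_2+\mathrm{ad}^*_{\eta_1}\nu-\mathrm{ad}^*_\xi\nu_1,\ \eta_2+[\eta_1,\xi])$; ''generated by'' an element depending on the point means this expression evaluated at that point. $\frac{\delta H}{\delta g}\in T_g^*G$, $\frac{\delta H}{\delta\mu},\frac{\delta H}{\delta\nu}\in\mathfrak g$, $\frac{\delta H}{\delta\xi}\in\mathfrak g^*$ are partial derivatives. *)

(* Defs.v *)
From HB Require Import structures.
From mathcomp Require Import all_boot all_order all_algebra.
From mathcomp Require Import all_classical all_reals all_analysis.
Set Implicit Arguments.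
Unset Strict Implicit.
Unset Printing Implicit Defensive.
Import Order.TTheory GRing.Theory Num.Theory.
Import numFieldNormedType.Exports.
Local Open Scope classical_set_scope.
Local Open Scope ring_scope.

(* C^k and C^oo maps on an open subset U of a finite-dimensional V, where     *)
(* C^(k+1) amounts to: differentiable with C^k directional derivatives.       *)
Fixpoint Ck (R : realType) (V W : normedModType R) (k : nat) (U : set V)
    (f : V -> W) : Prop :=
  match k with
  | 0 => forall x, U x -> {for x, continuous f}
  | k'.+1 => (forall x, U x -> differentiable f x) /\
             (forall v, Ck k' U (fun x => 'D_v f x))
  end.

Definition smooth_on (R : realType) (V W : normedModType R) (U : set V)
  (f : V -> W) : Prop := forall k, Ck k U f.

Record chart (R : realType) (M : Type) (E : normedModType R) := Chart {
  dom : set M;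
  cmap :> M -> E;
  cinv : E -> M
}.

(* An atlas with a preferred chart at each point.  The tangent space T_p M is *)
(* represented by the model space E through the preferred chart at p; all the *)
(* notions below are expressed with this representation.                      *)
Record charted (R : realType) (M : Type) (E : normedModType R) := Charted {
  atlas : set (chart M E);
  chart_at : M -> chart M E
}.

Definition vec_charted (R : realType) (E : normedModType R) : charted E E :=
  let c := Chart setT id id in Charted [set c] (fun=> c).

Definition prod_chart (R : realType) (M N : Type) (E F : normedModType R)
    (c : chart M E) (d : chart N F) : chart (M * N) (E * F)%type :=
  Chart (dom c `*` dom d) (fun p => (c p.1, d p.2))
        (fun x => (cinv c x.1, cinv d x.2)).

Definition prod_charted (R : realType) (M N : Type) (E F : normedModType R)
    (A : charted M E) (B : charted N F) : charted (M * N) (E * F)%type :=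
  Charted [set prod_chart c d | c in atlas A & d in atlas B]
          (fun p => prod_chart (chart_at A p.1) (chart_at B p.2)).

Definition smooth_map (R : realType) (M N : Type) (E F : normedModType R)
    (A : charted M E) (B : charted N F) (f : M -> N) : Prop :=
  forall p c d, atlas A c -> dom c p -> atlas B d -> dom d (f p) ->
    exists U : set E, [/\ open U, U (c p), U `<=` c @` dom c,
      f @` (cinv c @` U) `<=` dom d & smooth_on U (d \o f \o cinv c)].

(* T_p f : T_p M -> T_(f p) N *)
Definition tmap (R : realType) (M N : Type) (E F : normedModType R)
    (A : charted M E) (B : charted N F) (f : M -> N) (p : M) : E -> F :=
  'd (chart_at B (f p) \o f \o cinv (chart_at A p)) (chart_at A p p).

Definition has_velocity (R : realType) (M : Type) (E : normedModType R)
    (A : charted M E) (gamma : R -> M) (t : R) (v : E) : Prop :=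
  (\forall s \near t, dom (chart_at A (gamma t)) (gamma s)) /\
  is_derive t (1 : R) (chart_at A (gamma t) \o gamma) v.

Definition smooth_field (R : realType) (M : Type) (E : normedModType R)
    (A : charted M E) (X : M -> E) : Prop :=
  forall c, atlas A c -> smooth_on (c @` dom c)
    (fun x => tmap A (vec_charted E) c (cinv c x) (X (cinv c x))).

(* Exterior derivative of a 1-form, computed in the preferred chart c at p:   *)
(* d theta (u, v) = D_u (theta v) - D_v (theta u) for u, v constant in c,     *)
(* with no factor 1/2.                                                        *)
Definition ext_d (R : realType) (M : Type) (E : normedModType R)
    (A : charted M E) (theta : M -> E -> R) (p : M) (u v : E) : R :=
  let c := chart_at A p in
  let theta_c (w x : E) : R :=
    theta (cinv c x) (tmap (vec_charted E) A (cinv c) x w) in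
  'D_u (theta_c v) (c p) - 'D_v (theta_c u) (c p).

#[short(type="topGroupType")]
HB.structure Definition TopGroup := {G of Group G & Topological G}.

Record is_chart (R : realType) (M : topologicalType) (E : normedModType R)
    (c : chart M E) : Prop := IsChart {
  dom_open : open (dom c);
  img_open : open (c @` dom c);
  chartK : {in dom c, cancel c (cinv c)};
  chart_cont : {within dom c, continuous c};
  cinv_cont : {within c @` dom c, continuous (cinv c)}
}.

Record is_manifold (R : realType) (M : topologicalType) (E : normedModType R)
    (A : charted M E) : Prop := IsManifold {
  mfd_hausdorff : hausdorff_space M;
  mfd_countable : @second_countable M;
  mfd_chart : forall c, atlas A c -> is_chart c;
  mfd_chart_at : forall p, atlas A (chart_at A p);
  mfd_dom : forall p, dom (chart_at A p) p;
  mfd_smooth : forall c d, atlas A c -> atlas A d ->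
    smooth_on (c @` (dom c `&` dom d)) (d \o cinv c)
}.

Record lieGroup (R : realType) (n : nat) := LieGroup {
  lie_sort :> topGroupType;
  lie_charted : charted lie_sort 'rV[R]_n;
  lie_manifold : is_manifold lie_charted;
  lie_mul : smooth_map (prod_charted lie_charted lie_charted) lie_charted
              (fun p : lie_sort * lie_sort => (p.1 * p.2)%g);
  lie_inv : smooth_map lie_charted lie_charted (fun g : lie_sort => g^-1%g)
}.

(* Vectors of R^n are rows and covectors are columns. *)
Definition pairing (R : realType) (n : nat) (mu : 'cV[R]_n) (xi : 'rV[R]_n) : R :=
  (xi *m mu) 0 0.

(* <dual_map f mu, xi> = <mu, f xi> for linear f *)
Definition dual_map (R : realType) (m n : nat) (f : 'rV[R]_m -> 'rV[R]_n)
    (mu : 'cV[R]_n) : 'cV[R]_m := lin1_mx f *m mu.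

Definition real_charted (R : realType) : charted R R^o := vec_charted R^o.

Section LieGroupCalculus.
Variables (R : realType) (n : nat) (G : lieGroup R n).
Notation g_ := 'rV[R]_n.
Notation gs := 'cV[R]_n.
Notation AG := (lie_charted G).

(* T_e R_g : T_e G -> T_g G; its dual T_e^* R_g is dual_map (TeR g) *)
Definition TeR (g : G) : g_ -> g_ := tmap AG AG (fun h => h * g)%g 1%g.

Definition Ad (g : G) : g_ -> g_ := tmap AG AG (fun h => g * h * g^-1)%g 1%g.

(* exp is the exponential map of G: t |-> exp (t xi) is the one-parameter     *)
(* subgroup with initial velocity xi.                                         *)
Definition is_lie_exp (exp : g_ -> G) : Prop := forall xi : g_,
  [/\ smooth_map (real_charted R) AG (fun t : R => exp (t *: xi)),
      forall s t : R, exp ((s + t) *: xi) = (exp (s *: xi) * exp (t *: xi))%g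
    & has_velocity AG (fun t : R => exp (t *: xi)) 0 xi].

Variable exp : g_ -> G.

Definition ad (xi eta : g_) : g_ := 
  derive1 (fun t : R => Ad (exp (t *: xi)) eta) 0.

Definition ads (xi : g_) (mu : gs) : gs := - dual_map (ad xi) mu.

(* T^*G: points are pairs (g, alpha) with alpha in T_g^*G.  The chart induced *)
(* by a chart c of G is (g, alpha) |-> (c g, p) with p the components of      *)
(* alpha in c.                                                                *)
Definition cot_chart (c : chart G g_) : chart (G * gs) (g_ * gs)%type :=
  Chart (dom c `*` setT)
    (fun y => (c y.1, dual_map (tmap (vec_charted g_) AG (cinv c) (c y.1)) y.2))
    (fun x => (cinv c x.1,
               dual_map (tmap AG (vec_charted g_) c (cinv c x.1)) x.2)).

Definition cot_charted : charted (G * gs) (g_ * gs)%type :=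
  Charted [set cot_chart c | c in atlas AG] (fun y => cot_chart (chart_at AG y.1)).

Definition Q_charted : charted (G * gs) (g_ * gs)%type :=
  prod_charted AG (vec_charted gs).

(* T^*(G x g^* ) = T^*G x (g^* x g): the point ((g, alpha_g), (mu, alpha_mu)) *)
(* is the covector (alpha_g, alpha_mu) at (g, mu).                            *)
Definition TsQ : Type := ((G * gs) * (gs * g_))%type.

Definition TsQ_charted : charted TsQ ((g_ * gs) * (gs * g_))%type :=
  prod_charted cot_charted (prod_charted (vec_charted gs) (vec_charted g_)).

Definition TsQ_proj (y : TsQ) : G * gs := (y.1.1, y.2.1).

Definition liouville (y : TsQ) (w : ((g_ * gs) * (gs * g_))%type) : R :=
  let v := tmap TsQ_charted Q_charted TsQ_proj y w in
  pairing y.1.2 v.1 + pairing v.2 y.2.2.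

(* The trivialized T^*T^*G, with points (g, mu, nu, xi). *)
Definition TTG : Type := (G * gs * gs * g_)%type.
Definition TTG_model : normedModType R := (g_ * gs * gs * g_)%type.

Definition TTG_charted : charted TTG TTG_model :=
  prod_charted (prod_charted (prod_charted AG (vec_charted gs))
    (vec_charted gs)) (vec_charted g_).

(* The identification T^*(G x g^* ) -> G x g^* x g^* x g and its inverse; see  *)
(* trivK and triv_invK.                                                       *)
Definition triv (y : TsQ) : TTG :=
  let: ((g, alpha), (mu, xi)) := y in
  (g, mu, dual_map (TeR g) alpha - ads xi mu, xi).

Definition triv_inv (z : TTG) : TsQ :=
  let: (g, mu, nu, xi) := z in
  ((g, invmx (lin1_mx (TeR g)) *m (nu + ads xi mu)), (mu, xi)).

(* The canonical form d theta transported by triv. *)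
Definition Omega (z : TTG) (u v : TTG_model) : R :=
  ext_d TsQ_charted liouville (triv_inv z)
    (tmap TTG_charted TsQ_charted triv_inv z u)
    (tmap TTG_charted TsQ_charted triv_inv z v).

Definition hamiltonian_field (H : TTG -> R) (X : TTG -> TTG_model) : Prop :=
  forall z w, Omega z (X z) w = - tmap TTG_charted (real_charted R) H z w.

(* The vector at z = (g, mu, nu, xi) of the right invariant vector field       *)
(* generated by a, i.e. T_e R_z a for the group law                           *)
(*   (g, mu1, mu2, xi) (h, nu1, nu2, eta) =                                   *)
(*     (g h, mu1 + Ad_g^* nu1, mu2 + Ad_g^* nu2 - ad^*_(Ad_g eta) mu1,        *)
(*      xi + Ad_g eta).                                                       *)
Definition right_inv_vect (a : TTG_model) (z : TTG) : TTG_model :=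
  let: (eta1, nu1, nu2, eta2) := a in
  let: (g, mu, nu, xi) := z in
  (TeR g eta1, nu1 + ads eta1 mu, nu2 + ads eta1 nu - ads xi nu1,
   eta2 + ad eta1 xi).

(* The partial derivatives of H, as components: delta_g in T_g^*G, delta_mu    *)
(* and delta_nu in the bidual of g, which is g, and delta_xi in g^*.          *)
Definition delta_g (H : TTG -> R) (z : TTG) : gs :=
  let: (g, mu, nu, xi) := z in
  \col_i tmap AG (real_charted R) (fun h => H (h, mu, nu, xi)) g (delta_mx 0 i).

Definition delta_mu (H : TTG -> R) (z : TTG) : g_ :=
  let: (g, mu, nu, xi) := z in
  \row_i 'd (fun m => H (g, m, nu, xi) : R^o) mu (delta_mx i 0).

Definition delta_nu (H : TTG -> R) (z : TTG) : g_ :=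
  let: (g, mu, nu, xi) := z in
  \row_i 'd (fun m => H (g, mu, m, xi) : R^o) nu (delta_mx i 0).

Definition delta_xi (H : TTG -> R) (z : TTG) : gs :=
  let: (g, mu, nu, xi) := z in
  \col_i 'd (fun x => H (g, mu, nu, x) : R^o) xi (delta_mx 0 i).

End LieGroupCalculus.

Lemma rmul_chart (R : realType) (n : nat) (G : lieGroup R n) (h g : G) :
  let c := chart_at (lie_charted G) h in
  let d := chart_at (lie_charted G) (h * g)%g in
  differentiable (d \o (fun x : G => x * g)%g \o cinv c) (c h) /\
  \forall x \near c h, (c @` dom c) x /\ dom d (cinv c x * g)%g.
Proof.
move=> c d; have mfd := lie_manifold G.
pose b := chart_at (lie_charted G) g.
have bK : cinv b (b g) = g.
  apply: (chartK (mfd_chart mfd (mfd_chart_at mfd g))).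
  by rewrite inE; exact: (mfd_dom mfd g).
have Ac : atlas (prod_charted (lie_charted G) (lie_charted G)) (prod_chart c b).
  by exists c; [exact: mfd_chart_at|exists b => //; exact: mfd_chart_at].
have cp : dom (prod_chart c b) (h, g) by split; exact: mfd_dom.
have Ad : atlas (lie_charted G) d by exact: mfd_chart_at.
have dp : dom d (h * g)%g by exact: mfd_dom.
have [U [oU Up Usub Udom /(_ 1%N)[/(_ _ Up) dU _]]] :=
  lie_mul Ac cp Ad dp.
pose j (x : 'rV[R]_n) : 'rV[R]_n * 'rV[R]_n := (x, b g).
have dj : differentiable j (c h) by apply: differentiable_pair.
split.
  rewrite (_ : _ \o _ = (d \o (fun p : G * G => p.1 * p.2)%g \o
    cinv (prod_chart c b)) \o j); first exact: differentiable_comp.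
  by apply/funext => x /=; rewrite bK.
have Uj : nbhs (c h) (j @^-1` U).
  by apply: (differentiable_continuous dj); exact: open_nbhs_nbhs.
apply: filterS Uj => x Ux; split.
  have [[y z] [cy _] [<- _]] := Usub _ Ux.
  by exists y.
apply: Udom; exists (cinv c x, g) => //.
by exists (j x) => //=; rewrite bK.
Qed.

Lemma near_cancel_diff (R : realType) (V W : normedModType R) (f : V -> W)
    (k : W -> V) (x : V) :
  differentiable f x -> differentiable k (f x) ->
  (\near x, (k \o f) x = x) -> forall v, 'd k (f x) ('d f x v) = v.
Proof.
move=> df dk kf v.
have dkf : differentiable (k \o f) x by exact: differentiable_comp.
have -> : 'd k (f x) ('d f x v) = 'd (k \o f) x v.
  by rewrite (diff_comp df dk).
by rewrite -deriveE // (@near_eq_derive _ _ _ _ id) // derive_id.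
Qed.

Lemma TeR_unitmx (R : realType) (n : nat) (G : lieGroup R n) (g : G) :
  lin1_mx (TeR g) \in unitmx.
Proof.
have mfd := lie_manifold G.
pose c := chart_at (lie_charted G) 1%g.
pose d := chart_at (lie_charted G) (1 * g)%g.
have cc : is_chart c by exact/mfd_chart/mfd_chart_at.
have dd : is_chart d by exact/mfd_chart/mfd_chart_at.
pose f := d \o (fun x : G => x * g)%g \o cinv c.
pose k := c \o (fun x : G => x * g^-1)%g \o cinv d.
have [df nf] := rmul_chart 1%g g.
have [dk _] := rmul_chart (1 * g)%g g^-1%g.
rewrite mulgK -/c in dk.
have fc : f (c 1%g) = d (1 * g)%g.
  rewrite /f /= (chartK cc) // inE; exact: mfd_dom.
have kf : \forall x \near c 1%g, (k \o f) x = x.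
  apply: filterS nf => x [[y cy <-]] /=.
  rewrite /k /f /= (chartK cc) ?inE // => dy.
  by rewrite (chartK dd) ?inE // mulgK.
have dk' : differentiable k (f (c 1%g)) by rewrite fc.
have did := near_cancel_diff df dk' kf.
have fk : lin1_mx (TeR g) *m lin1_mx ('d k (f (c 1%g))) = 1%:M.
  apply/row_matrixP => i; rewrite row_mul row1 rowE mul_rV_lin1.
  by rewrite /TeR /tmap -/c mul_rV_lin1 did.
by case: (mulmx1_unit fk) => uTeR _; exact: uTeR.
Qed.

Lemma triv_invK (R : realType) (n : nat) (G : lieGroup R n)
  (exp : 'rV[R]_n -> G) : cancel (triv_inv exp) (triv exp).
Proof.
move=> [[[g mu] nu] xi] /=.
by rewrite /dual_map mulKVmx ?TeR_unitmx // addrK.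
Qed.

Lemma trivK (R : realType) (n : nat) (G : lieGroup R n)
  (exp : 'rV[R]_n -> G) : cancel (triv exp) (triv_inv exp).
Proof.
move=> [[g alpha] [mu xi]] /=.
by rewrite subrK /dual_map mulKmx ?TeR_unitmx.
Qed.

(* Main.v *)
Require Import Defs.
From HB Require Import structures.
From mathcomp Require Import all_boot all_order all_algebra perm ring.
From mathcomp Require Import all_classical all_reals all_analysis.
Set Implicit Arguments.
Unset Strict Implicit.
Unset Printing Implicit Defensive.
Import Order.TTheory GRing.Theory Num.Theory.
Import numFieldNormedType.Exports.
Local Open Scope classical_set_scope.
Local Open Scope ring_scope.

(** In a chart c of G around g, with m the multiplication read in charts and
    rho_x eta the right invariant field generated by eta, the canonical form is
    constant: (u, v) |-> <u_p, v_x> - <v_p, u_x> + <v_mu, u_xi> - <u_mu, v_xi>.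
    The trivialization has local expression p = (rho_x^* )^-1 (nu + ad^*_xi mu),
    so pulling the form back to G x g^* x g^* x g only requires the derivative of
    rho.  Differentiating the associativity law twice and using the symmetry of
    second derivatives gives the Maurer-Cartan equation
      D_(rho eta) (rho zeta) - D_(rho zeta) (rho eta) = - rho [eta, zeta],
    which makes the pulled back form explicit on right trivialized vectors.  That
    form is nondegenerate, whence uniqueness, and substituting the announced
    vector field in it gives -dH; the cubic terms cancel by the Jacobi identity. *)

(** * C^k calculus in finite dimension *)

(** Two features of the setting shape the proof. A tangent vector at g is stored through the
    preferred chart at g, which may jump from point to point, so [TeR g] cannot be differentiated in
    g. Every derivative is therefore taken in one fixed chart c, where [rfield c] replaces [TeR],
    and the transition differential at the point converts between the two. Moreover ['d] is a junk
    value where differentiability fails, and chart maps are arbitrary off their domains, so each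
    differential is read off from a differentiable formula that agrees with the chart expression
    near the point.

    The bracket is not introduced through [ad], a derivative along [exp] with no visible linearity
    in its first argument, but as the antisymmetrized second derivative of the multiplication at (1,
    1). Antisymmetry and bilinearity then follow at once, and the Maurer-Cartan equation involves no
    exponential; [exp] serves to identify [ad] with this bracket and to prove the Jacobi identity,
    by differentiating the fact that [Ad g] preserves the bracket. *)

Section Differentials.
Variable R : realType.
Implicit Types U V W X : normedModType R.

(** Equal directional derivatives would not yield differentiability, so the little-o expansion of
    [f] is itself carried over to [g]. *)
Lemma near_eq_diff V W (f g : V -> W) x :
  (\near x, f x = g x) -> differentiable f x -> differentiable g x.
Proof.
move=> fg df.
have [dfc dfx] := (diff_locallyP _ _).1 df.
have gx : g \o shift x = cst (g x) + 'd f x +o_ 0 id.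
  apply/eqaddoP => e e0.
  have fgx : f x = g x by exact: nbhs_singleton fg.
  have fg0 : \forall h \near 0, f (h + x) = g (h + x).
    by move: fg; rewrite (near_shift 0) subr0.
  move/eqaddoP: dfx => /(_ e e0); apply: filterS2 fg0 => h fgh /=.
  by rewrite /= !fctE /= fgh fgx.
apply/diff_locallyP; rewrite (diff_unique dfc gx); split => //.
Qed.

(** The tool for all chart computations: an expression in charts simplifies only where the charts
    are inverted by their inverses, so its differential is that of a simpler map equal to it
    nearby. *)
Lemma near_eq_is_diff V W (f g : V -> W) x df :
  (\near x, f x = g x) -> is_diff x f df -> is_diff x g df.
Proof.
move=> fg [ef <-]; have eg := near_eq_diff fg ef.
apply: DiffDef; first exact: eg.
apply/funext => v; apply: etrans (esym (deriveE v eg)) (etrans _ (deriveE v ef)).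
by apply: near_eq_derive; apply: filterS fg => y ->.
Qed.

Lemma is_diff_uniq V W (f df df' : V -> W) x :
  is_diff x f df -> is_diff x f df' -> forall v, df v = df' v.
Proof. by move=> [_ <-] [_ <-]. Qed.

Lemma diff_is_derive V W (f df : V -> W) x v :
  is_diff x f df -> is_derive x v f (df v).
Proof.
by move=> [ef <-]; rewrite -deriveE //; apply/derivableP/diff_derivable.
Qed.

Lemma is_diff_lin V W (f : {linear V -> W}) x :
  continuous f -> is_diff x f f.
Proof.
move=> cf; apply: DiffDef; first exact: linear_differentiable.
by rewrite diff_lin.
Qed.

Lemma is_diff_fst V W (x : V * W) : is_diff x (@fst V W) fst.
Proof. by apply: is_diff_lin => y; exact: cvg_fst. Qed.

Lemma is_diff_snd V W (x : V * W) : is_diff x (@snd V W) snd.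
Proof. by apply: is_diff_lin => y; exact: cvg_snd. Qed.

Lemma is_derive_line V W (f : V -> W) x u (r : R) :
  differentiable f (x + r *: u) ->
  is_derive r (1 : R) (fun s => f (x + s *: u)) ('D_u f (x + r *: u)).
Proof.
move=> df; rewrite deriveE //.
have dl : is_diff r (fun s : R => x + s *: u) ( *:%R ^~ u).
  by apply: is_diff_eq; rewrite add0r.
have dc : is_diff r (f \o (fun s => x + s *: u)) ('d f (x + r *: u) \o ( *:%R ^~ u)).
  by apply: is_diff_comp => //; apply: differentiableP.
by have := diff_is_derive (1 : R) dc; rewrite /= scale1r.
Qed.

(** Mean value theorem twice: along [u] for the increment of [f] in direction [v], then along [v]
    for ['D_u f]. *)
Lemma second_difference V (f : V -> R^o) x u v (s : R) : 0 < s ->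
  (forall a b, 0 <= a <= s -> 0 <= b <= s ->
    differentiable f (x + a *: u + b *: v) /\
    differentiable ('D_u f) (x + a *: u + b *: v)) ->
  exists a b, [/\ 0 <= a <= s, 0 <= b <= s &
    f (x + s *: u + s *: v) - f (x + s *: u) - (f (x + s *: v) - f x) =
    'D_v ('D_u f) (x + a *: u + b *: v) * s * s].
Proof.
move=> s0 df.
have s0' := ltW s0.
have ss : 0 <= s <= s by apply/andP.
have zs : 0 <= (0 : R) <= s by apply/andP.
pose g (r : R) := f (x + s *: v + r *: u) - f (x + r *: u) : R.
pose dg (r : R) := 'D_u f (x + s *: v + r *: u) - 'D_u f (x + r *: u) : R.
have gd (r : R) : 0 <= r <= s -> is_derive r 1 g (dg r).
  move=> rs; apply: is_deriveB.
    apply: is_derive_line; rewrite addrAC; exact: (df _ _ rs ss).1.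
  apply: is_derive_line.
  by have := (df _ _ rs zs).1; rewrite scale0r addr0.
have [||a] := @MVT R g dg 0 s s0.
- by move=> r; rewrite in_itv /= => /andP[r0 rs]; apply: gd; rewrite (ltW r0) (ltW rs).
- apply: derivable_within_continuous => r; rewrite in_itv /= => rs.
  by have [] := gd _ rs.
rewrite in_itv /= => /andP[a0 as_] ga.
have aS : 0 <= a <= s by rewrite (ltW a0) (ltW as_).
pose k (r : R) := 'D_u f (x + a *: u + r *: v) : R.
pose dk (r : R) := 'D_v ('D_u f) (x + a *: u + r *: v) : R.
have kd (r : R) : 0 <= r <= s -> is_derive r 1 k (dk r).
  by move=> rs; apply: is_derive_line; exact: (df _ _ aS rs).2.
have [||b] := @MVT R k dk 0 s s0.
- by move=> r; rewrite in_itv /= => /andP[r0 rs]; apply: kd; rewrite (ltW r0) (ltW rs).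
- apply: derivable_within_continuous => r; rewrite in_itv /= => rs.
  by have [] := kd _ rs.
rewrite in_itv /= => /andP[b0 bs] kb.
exists a, b; split => //; first by rewrite (ltW b0) (ltW bs).
move: ga; rewrite /g !scale0r !addr0 subr0 => ga.
move: kb; rewrite /k !scale0r !addr0 subr0 => kb.
transitivity (dg a * s).
  rewrite -ga (addrAC x (s *: v)); congr (_ - _).
by rewrite -/(dk b) -kb /dg (addrAC x (s *: v)).
Qed.

End Differentials.

Section Ck.
Variable R : realType.
Implicit Types U V W X : normedModType R.

(** The conditions in [Ck] concern [f] near single points in the ambient space, so the sets [B] may
    vary with the point. A smooth map of manifolds provides only such sets. *)
Lemma Ck_cover V W k (A : set V) (f : V -> W) :
  (forall x, A x -> exists2 B, B x & Ck k B f) -> Ck k A f.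
Proof.
elim: k f => [|k IH] f /= Af; first by move=> x /Af[B Bx]; exact.
split=> [x /Af[B Bx [+ _]]|v]; first exact.
by apply: IH => x /Af[B Bx [_ /(_ v) ?]]; exists B.
Qed.

Lemma eq_Ck V W k (A : set V) (f g : V -> W) :
  open A -> (forall x, A x -> f x = g x) -> Ck k A f -> Ck k A g.
Proof.
move=> oA; elim: k f g => [|k IH] f g fg /= Af.
  move=> x Ax; have fgx : \near x, f x = g x.
    by apply: filterS (open_nbhs_nbhs _); [exact: fg|].
  apply: cvg_trans (near_eq_cvg fgx) _; rewrite -(fg _ Ax).
  exact: Af.
have fgx x : A x -> \near x, f x = g x.
  by move=> Ax; apply: filterS (open_nbhs_nbhs _); [exact: fg|].
split=> [x Ax|v]; first by apply: near_eq_diff (fgx _ Ax) _; exact: Af.1.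
apply: IH (Af.2 v) => x Ax; apply: near_eq_derive; exact: fgx.
Qed.

Lemma CkSW V W k (A : set V) (f : V -> W) : Ck k.+1 A f -> Ck k A f.
Proof.
elim: k f => [|k IH] f [df Df].
  by move=> x /df/differentiable_continuous.
by split=> // v; apply: IH.
Qed.

Lemma Ck_cst V W k (A : set V) (w : W) : Ck k A (cst w).
Proof.
elim: k w => [|k IH] w /=; first by move=> x _; exact: cvg_cst.
split=> // v; rewrite (_ : (fun _ => _) = cst 0) //.
by apply/funext => x; exact: derive_cst.
Qed.

Lemma Ck_lin V W k (A : set V) (f : {linear V -> W}) :
  continuous f -> Ck k A f.
Proof.
case: k => [|k] cf /=; first by move=> x _; exact: cf.
split=> [x _|v]; first exact: linear_differentiable.
rewrite (_ : (fun _ => _) = cst (f v)); first exact: Ck_cst.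
by apply/funext => x; rewrite deriveE ?diff_lin //; exact: linear_differentiable.
Qed.

Lemma CkD V W k (A : set V) (f g : V -> W) : open A ->
  Ck k A f -> Ck k A g -> Ck k A (f + g).
Proof.
move=> oA; elim: k f g => [|k IH] f g /=.
  by move=> cf cg x Ax; apply: continuousD; [exact: cf|exact: cg].
move=> [df Df] [dg Dg]; split=> [x Ax|v].
  by apply: differentiableD; [exact: df|exact: dg].
apply: eq_Ck (IH _ _ (Df v) (Dg v)) => // x Ax.
by rewrite deriveD //; apply: diff_derivable; [exact: df|exact: dg].
Qed.

Lemma Ck_sum V W k (A : set V) (I : Type) (r : seq I) (f : I -> V -> W) :
  open A -> (forall i, Ck k A (f i)) -> Ck k A (fun x => \sum_(i <- r) f i x).
Proof.
move=> oA Af; elim: r => [|i r IH].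
  by apply: eq_Ck (Ck_cst k A (0 : W)) => // x _; rewrite big_nil.
by apply: eq_Ck (CkD oA (Af i) IH) => // x _; rewrite big_cons.
Qed.

Lemma Ck_complin V W X k (A : set V) (L : {linear W -> X}) (f : V -> W) :
  continuous L -> open A -> Ck k A f -> Ck k A (L \o f).
Proof.
move=> cL oA; elim: k f => [|k IH] f /=.
  by move=> cf x Ax; apply: continuous_comp; [exact: cf|exact: cL].
move=> [df Df].
have dL y : is_diff y L L by exact: is_diff_lin.
split=> [x Ax|v]; first by apply: differentiable_comp => //; exact: df.
apply: eq_Ck (IH _ (Df v)) => // x Ax /=.
rewrite [RHS]deriveE; last by apply: differentiable_comp => //; exact: df.
by rewrite diff_comp ?diff_lin //= ?deriveE //; exact: df.
Qed.

Lemma scale_is_bilinear W : bilinear_for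
    (GRing.Scale.Law.clone _ _ *:%R _) (GRing.Scale.Law.clone _ _ *:%R _)
    (fun (a : R^o) (w : W) => a *: w).
Proof.
split=> [w|a] b x y /=; first by rewrite scalerDl scalerA.
by rewrite scalerDr !scalerA mulrC.
Qed.

Lemma is_diff_scale V W (f df : V -> R^o) (g dg : V -> W) x :
  is_diff x f df -> is_diff x g dg ->
  is_diff x (fun y => f y *: g y) (fun v => f x *: dg v + df v *: g x).
Proof.
move=> fx gx.
pose sM := bilinear_isBilinear.Build R R^o W W _ _ _ (@scale_is_bilinear W).
pose s : {bilinear R^o -> W -> W} :=
  HB.pack (fun (a : R^o) (w : W) => a *: w) sM.
have sc : continuous (fun p : R^o * W => s p.1 p.2).
  by move=> p; exact: scale_continuous.
have sp p : is_diff p (fun q : R^o * W => s q.1 q.2)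
    (fun q => s p.1 q.2 + s q.1 p.2).
  by apply: DiffDef; [exact: differentiable_bilin|exact: diff_bilin].
exact: (is_diff_comp (is_diff_pair fx gx) (sp (f x, g x))).
Qed.

Lemma Ck_scale V W k (A : set V) (f : V -> R^o) (g : V -> W) : open A ->
  Ck k A f -> Ck k A g -> Ck k A (fun x => f x *: g x).
Proof.
move=> oA; elim: k f g => [|k IH] f g.
  by move=> /= cf cg x Ax; apply: continuousZ; [exact: cf|exact: cg].
move=> Cf Cg; have [df Df] := Cf; have [dg Dg] := Cg.
have dfg x : A x -> is_diff x (fun x => f x *: g x)
    (fun v => f x *: 'd g x v + 'd f x v *: g x).
  by move=> Ax; apply: is_diff_scale;
     apply: differentiableP; [exact: df|exact: dg].
split=> [x Ax|v]; first by have [] := dfg _ Ax.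
have C1 := IH _ _ (CkSW Cf) (Dg v); have C2 := IH _ _ (Df v) (CkSW Cg).
apply: eq_Ck (CkD oA C1 C2) => // x Ax.
have [ex ->] := diff_is_derive v (dfg _ Ax).
by rewrite -!deriveE; [|exact: df|exact: dg].
Qed.

Lemma Ck_pair V W X k (A : set V) (f : V -> W) (g : V -> X) : open A ->
  Ck k A f -> Ck k A g -> Ck k A (fun x => (f x, g x)).
Proof.
move=> oA; elim: k f g => [|k IH] f g /=.
  by move=> cf cg x Ax; apply: cvg_pair; [exact: cf|exact: cg].
move=> [df Df] [dg Dg].
split=> [x Ax|v]; first by apply: differentiable_pair; [exact: df|exact: dg].
apply: eq_Ck (IH _ _ (Df v) (Dg v)) => // x Ax.
have [fx gx] := (df x Ax, dg x Ax).
by rewrite !deriveE ?diff_pair //; exact: differentiable_pair.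
Qed.

(* Stands for finite dimension: the chain rule for Ck, whose definition only has
   directional derivatives, has to expand a derivative in a basis. *)
Definition finite_basis V := exists (I : finType) (e : I -> V)
  (phi : I -> {linear V -> R^o}),
  (forall i, continuous (phi i)) /\ forall v, v = \sum_i phi i v *: e i.

(** The derivative of [g \o f] along [v] is the derivative of [g] along ['D_v f x], a direction that
    moves with [x]. Expanding it in the basis leaves the fixed directions [e i], to which the
    induction hypothesis applies. *)
Lemma Ck_comp V W X k (A : set V) (B : set W) (f : V -> W) (g : W -> X) :
  finite_basis W -> open A -> (forall x, A x -> B (f x)) ->
  Ck k A f -> Ck k B g -> Ck k A (g \o f).
Proof.
move=> [I [e [phi [cphi phiE]]]] oA AB; elim: k f g AB => [|k IH] f g AB.
  move=> /= cf cg x Ax; apply: continuous_comp; first exact: cf.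
  exact/cg/AB.
move=> Cf Cg; have [df Df] := Cf; have [dg Dg] := Cg.
split=> [x Ax|v].
  by apply: differentiable_comp; [exact: df|exact/dg/AB].
pose h i (x : V) : X := phi i ('D_v f x) *: 'D_(e i) g (f x).
suff Ch : Ck k A (fun x => \sum_i h i x).
  apply: eq_Ck Ch => // x Ax.
  have [fx gx] := (df x Ax, dg _ (AB x Ax)).
  rewrite [RHS]deriveE; last exact: differentiable_comp.
  rewrite diff_comp //= -(deriveE v fx) [in RHS](phiE ('D_v f x)) linear_sum.
  by apply: eq_bigr => i _; rewrite linearZ /= /h -deriveE.
apply: Ck_sum => // i; apply: Ck_scale => //.
  exact: (Ck_complin (cphi i) oA (Df v)).
exact: (IH f (fun y => 'D_(e i) g y) AB (CkSW Cf) (Dg (e i))).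
Qed.

Lemma Ck_add V W k (A : set V) (f g : V -> W) : open A ->
  Ck k A f -> Ck k A g -> Ck k A (fun x => f x + g x).
Proof. exact: CkD. Qed.

Lemma Ck_opp V W k (A : set V) (f : V -> W) : open A ->
  Ck k A f -> Ck k A (fun x => - f x).
Proof.
move=> oA Cf; have := Ck_scale oA (Ck_cst k A (-1 : R^o)) Cf.
by apply: eq_Ck => // x _; rewrite scaleN1r.
Qed.

Lemma Ck_fst U V W k (A : set U) (f : U -> V * W) : open A ->
  Ck k A f -> Ck k A (fun x => (f x).1).
Proof. by move=> oA Cf; apply: (Ck_complin (L := fst)) => // Z; exact: cvg_fst. Qed.

Lemma Ck_snd U V W k (A : set U) (f : U -> V * W) : open A ->
  Ck k A f -> Ck k A (fun x => (f x).2).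
Proof. by move=> oA Cf; apply: (Ck_complin (L := snd)) => // Z; exact: cvg_snd. Qed.

Lemma Ck_id V k (A : set V) : Ck k A id.
Proof. by apply: (@Ck_lin _ _ _ _ idfun) => x; exact: cvg_id. Qed.

Lemma Ck_coord V k m n (A : set V) (f : V -> 'M[R]_(m, n)) i j : open A ->
  Ck k A f -> Ck k A (fun x => f x i j : R^o).
Proof.
pose c : {linear 'M[R]_(m, n) -> R^o} := HB.pack
  (fun M : 'M[R]_(m, n) => M i j : R^o)
  (GRing.isLinear.Build _ _ _ _ (fun M : 'M[R]_(m, n) => M i j : R^o)
    (fun a M N => etrans (mxE _ _ i j) (congr1 (+%R^~ (N i j)) (mxE _ _ i j)))).
by apply: (Ck_complin (L := c)) => //; exact: coord_continuous.
Qed.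

Lemma finite_basis_mx m n : finite_basis 'M[R]_(m, n).
Proof.
have cl (ij : 'I_m * 'I_n) :
    linear (fun M : 'M[R]_(m, n) => M ij.1 ij.2 : R^o).
  by move=> a M N; rewrite !mxE.
pose c ij : {linear 'M[R]_(m, n) -> R^o} :=
  HB.pack (fun M : 'M[R]_(m, n) => M ij.1 ij.2 : R^o)
    (GRing.isLinear.Build _ _ _ _ _ (cl ij)).
exists ('I_m * 'I_n)%type, (fun ij => delta_mx ij.1 ij.2), c; split.
  by move=> ij; exact: coord_continuous.
by move=> M; rewrite [LHS]matrix_sum_delta pair_bigA.
Qed.

Lemma finite_basis_prod V W :
  finite_basis V -> finite_basis W -> finite_basis (V * W)%type.
Proof.
move=> [I [e [phi [cphi phiE]]]] [J [f [psi [cpsi psiE]]]].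
have lF (ij : I + J) : linear (fun p : V * W => match ij with
    | inl i => phi i p.1 | inr j => psi j p.2 end : R^o).
  by case: ij => i a p q /=; rewrite linearP.
pose c ij : {linear (V * W)%type -> R^o} := HB.pack
  (fun p : V * W => match ij with
    | inl i => phi i p.1 | inr j => psi j p.2 end : R^o)
    (GRing.isLinear.Build _ _ _ _ _ (lF ij)).
exists (I + J)%type,
  (fun ij => match ij with inl i => (e i, 0) | inr j => (0, f j) end), c; split.
  case=> i p /=.
    by apply: (@continuous_comp _ _ _ fst (phi i)); [exact: cvg_fst|exact: cphi].
  by apply: (@continuous_comp _ _ _ snd (psi i)); [exact: cvg_snd|exact: cpsi].
move=> [v w]; rewrite big_sumType /=; congr pair => /=.
  rewrite (linear_sum (@fst V W)) (linear_sum (@fst V W)) /=.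
  rewrite [X in _ = _ + X]big1 => [|j _]; last by rewrite scaler0.
  by rewrite addr0; exact: phiE.
rewrite (linear_sum (@snd V W)) (linear_sum (@snd V W)) /=.
rewrite [X in _ = X + _]big1 => [|i _]; last by rewrite scaler0.
by rewrite add0r; exact: psiE.
Qed.

Lemma Ck_mx V m n k (A : set V) (f : V -> 'M[R]_(m, n)) : open A ->
  (forall i j, Ck k A (fun x => f x i j : R^o)) -> Ck k A f.
Proof.
move=> oA Af.
apply: (@eq_Ck _ _ _ A (fun x => \sum_i \sum_j (f x i j) *: delta_mx i j)) => //.
  by move=> x _; rewrite [RHS]matrix_sum_delta.
apply: Ck_sum => // i; apply: Ck_sum => // j; apply: Ck_scale => //.
exact: Ck_cst.
Qed.

Lemma is_diff_sum V W (I : Type) (r : seq I) (g dg : I -> V -> W) x :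
  (forall i, is_diff x (g i) (dg i)) ->
  is_diff x (fun y => \sum_(i <- r) g i y) (fun v => \sum_(i <- r) dg i v).
Proof.
move=> gd.
rewrite (_ : (fun y => _) = \sum_(i <- r) g i); last first.
  by apply/funext => y; rewrite fct_sumE.
rewrite (_ : (fun v => _) = \sum_(i <- r) dg i); last first.
  by apply/funext => y; rewrite fct_sumE.
elim: r => [|i r IH]; first by rewrite !big_nil; exact: is_diff_cst.
by rewrite !big_cons; exact: is_diffD.
Qed.

Lemma is_diff_mx V m n (f df : V -> 'M[R]_(m, n)) x :
  (forall i j, is_diff x (fun y => f y i j : R^o) (fun v => df v i j)) ->
  is_diff x f df.
Proof.
move=> dfij.
rewrite (funext (fun y => matrix_sum_delta (f y))).
have dE i j := is_diff_scale (dfij i j) (is_diff_cst (delta_mx i j) x).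
apply: is_diff_eq (is_diff_sum _ (fun i => is_diff_sum _ (dE i))) _.
apply/funext => v; rewrite [RHS]matrix_sum_delta.
apply: eq_bigr => i _; apply: eq_bigr => j _ /=.
by rewrite scaler0 add0r.
Qed.

Lemma near_continuous2 V (f g : V -> R^o) x (A : set V) e : nbhs x A -> 0 < e ->
  {for x, continuous f} -> {for x, continuous g} ->
  exists2 d, 0 < d & forall y, ball x d y ->
    [/\ A y, `|f x - f y| < e & `|g x - g y| < e].
Proof.
move=> nA e0 /cvgrPdist_lt/(_ _ e0) nf /cvgrPdist_lt/(_ _ e0) ng.
have [d /= d0 dP] := (nbhs_ballP _ _).1 (filterI nA (filterI nf ng)).
by exists d => // y /dP[Ay [fy gy]]; split.
Qed.

(** The second difference over a small square is the same number in both orders, so a value of one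
    mixed derivative equals a value of the other at points near [x]. Continuity of both at [x]
    bounds the remaining gap by [e]. *)
Lemma Ck_schwarz V (A : set V) (f : V -> R^o) x u v :
  open A -> A x -> Ck 2 A f -> 'D_u ('D_v f) x = 'D_v ('D_u f) x.
Proof.
move=> oA Ax [df Df].
have c_uv w w' : {for x, continuous ('D_w ('D_w' f))}.
  exact: (((Df w').2 w) _ Ax).
apply/eqP; rewrite -subr_eq0 -normr_le0; apply/ler_addgt0Pl => e e0.
rewrite addr0.
have e20 : 0 < e / 2 by rewrite divr_gt0.
pose P y := [/\ A y, `|'D_u ('D_v f) x - 'D_u ('D_v f) y| < e / 2 &
                    `|'D_v ('D_u f) x - 'D_v ('D_u f) y| < e / 2].
have [d d0 dP] : exists2 d, 0 < d & forall y, ball x d y -> P y.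
  exact: near_continuous2 (open_nbhs_nbhs (conj oA Ax)) e20 (c_uv u v) (c_uv v u).
have [s s0 sP] : exists2 s, 0 < s & forall a b, 0 <= a <= s -> 0 <= b <= s ->
    P (x + a *: u + b *: v).
  have m0 : 0 < `|u| + `|v| + 1 by rewrite ltr_wpDl ?addr_ge0.
  (* This side keeps the square in the ball of radius [d]: the half makes the inequality strict and
     the [+ 1] covers [u = v = 0]. *)
  exists (d / 2 / (`|u| + `|v| + 1)); first by rewrite !divr_gt0.
  move=> a b /andP[a0 a1] /andP[b0 b1]; apply: dP; rewrite -ball_normE /=.
  rewrite -addrA opprD addrA subrr add0r normrN.
  apply: (le_lt_trans (ler_normD _ _)); rewrite !normrZ !ger0_norm //.
  apply: (@le_lt_trans _ _ (d / 2 / (`|u| + `|v| + 1) * (`|u| + `|v| + 1))).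
    rewrite !mulrDr mulr1 ler_wpDr ?(ltW (divr_gt0 _ _)) ?divr_gt0 //.
    by rewrite lerD // ler_wpM2r.
  by rewrite divfK ?gt_eqF // ltr_pdivrMr // ltr_pMr // ltr1n.
have [a [b [aS bS E1]]] : exists a b, [/\ 0 <= a <= s, 0 <= b <= s &
    f (x + s *: u + s *: v) - f (x + s *: u) - (f (x + s *: v) - f x) =
    'D_v ('D_u f) (x + a *: u + b *: v) * s * s].
  apply: second_difference => // a b aS bS; have [Ay _ _] := sP _ _ aS bS.
  by split; [exact: df|exact: (Df u).1].
have [b' [a' [bS' aS' E2]]] : exists b a, [/\ 0 <= b <= s, 0 <= a <= s &
    f (x + s *: v + s *: u) - f (x + s *: v) - (f (x + s *: u) - f x) =
    'D_u ('D_v f) (x + b *: v + a *: u) * s * s].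
  apply: second_difference => // b0 a0 bS0 aS0; have [Ay _ _] := sP _ _ aS0 bS0.
  by rewrite addrAC; split; [exact: df|exact: (Df v).1].
have E : 'D_v ('D_u f) (x + a *: u + b *: v) =
         'D_u ('D_v f) (x + a' *: u + b' *: v).
  have s1 : s != 0 by rewrite gt_eqF.
  (* Exchanging the two middle corners identifies the second differences of the two orders. *)
  have sub4 (a1 a2 a3 a4 : R) : a1 - a2 - (a3 - a4) = a1 - a3 - (a2 - a4).
    by rewrite !opprB addrACA [RHS]addrACA (addrC (- a2)).
  move: E2; rewrite (addrAC x (b' *: v)) (addrAC x (s *: v)) sub4 => E2.
  by apply: (mulIf s1); apply: (mulIf s1); exact: etrans (esym E1) E2.
have [_ _ P1] := sP _ _ aS bS; have [_ P2 _] := sP _ _ aS' bS'.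
rewrite E in P1; apply: (le_trans (ler_distD _ _ _)) (_ : _ + _ <= e).
rewrite [leRHS]splitr; apply: lerD; first exact: ltW P2.
by rewrite distrC; exact: ltW P1.
Qed.

End Ck.

(** * Product rules for bilinear maps, matrix inverses, partial differentials *)

Section Bilinear.
Variable R : realType.
Implicit Types U V W X : normedModType R.

Lemma is_diff_complin V W X (L : {linear W -> X}) (f df : V -> W) x :
  continuous L -> is_diff x f df -> is_diff x (fun y => L (f y)) (fun v => L (df v)).
Proof. by move=> cL fx; exact: (is_diff_comp fx (is_diff_lin (f x) cL)). Qed.

Section bilin.
Variables (V W X : normedModType R) (b : V -> W -> X).
Hypothesis bl : forall w, linear (b ^~ w).
Hypothesis br : forall v, linear (b v).

Lemma bilin_expand (I J : finType) (e : I -> V) (f : J -> W)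
    (phi : I -> {linear V -> R^o})
    (psi : J -> {linear W -> R^o}) v w :
  v = \sum_i phi i v *: e i -> w = \sum_j psi j w *: f j ->
  b v w = \sum_i \sum_j phi i v *: (psi j w *: b (e i) (f j)).
Proof.
move=> vE wE.
pose L u : {linear V -> X} := HB.pack (b ^~ u) (GRing.isLinear.Build _ _ _ _ _ (bl u)).
pose M u : {linear W -> X} := HB.pack (b u) (GRing.isLinear.Build _ _ _ _ _ (br u)).
rewrite [in LHS]vE -[LHS]/(L w _) linear_sum; apply: eq_bigr => i _.
rewrite linearZ -scaler_sumr; congr (_ *: _).
rewrite /= [in LHS]wE -[LHS]/(M (e i) _) linear_sum; apply: eq_bigr => j _.
by rewrite linearZ.
Qed.

Hypothesis fV : finite_basis V.
Hypothesis fW : finite_basis W.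

(** Expansion in bases turns [b] into a finite sum of products of continuous coordinates, so
    bilinearity alone gives the product rule. It is applied to matrix products, the bracket, [ads]
    and the pairing. *)
Lemma is_diff_bilin U (f df : U -> V) (g dg : U -> W) x :
  is_diff x f df -> is_diff x g dg ->
  is_diff x (fun y => b (f y) (g y)) (fun v => b (f x) (dg v) + b (df v) (g x)).
Proof.
move=> dfx dgx.
have [I [e [phi [cphi phiE]]]] := fV; have [J [e' [psi [cpsi psiE]]]] := fW.
have bE v w := bilin_expand (phiE v) (psiE w).
have fphi i := is_diff_complin (cphi i) dfx.
have gpsi j := is_diff_complin (cpsi j) dgx.
rewrite (funext (fun y => bE (f y) (g y))).
have dij i j := is_diff_scale (fphi i)
  (is_diff_scale (gpsi j) (is_diff_cst (b (e i) (e' j)) x)).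
apply: is_diff_eq (is_diff_sum _ (fun i => is_diff_sum _ (dij i))) _.
apply/funext => v; rewrite !bE -big_split; apply: eq_bigr => i _.
rewrite -big_split; apply: eq_bigr => j _ /=.
by rewrite scaler0 add0r.
Qed.

Lemma Ck_bilin U k (A : set U) (f : U -> V) (g : U -> W) : open A ->
  Ck k A f -> Ck k A g -> Ck k A (fun y => b (f y) (g y)).
Proof.
move=> oA Cf Cg.
have [I [e [phi [cphi phiE]]]] := fV; have [J [e' [psi [cpsi psiE]]]] := fW.
have bE v w := bilin_expand (phiE v) (psiE w).
rewrite (funext (fun y => bE (f y) (g y))).
apply: Ck_sum => // i; apply: Ck_sum => // j; apply: Ck_scale => //.
  exact: (Ck_complin (cphi i) oA Cf).
apply: Ck_scale => //; last exact: Ck_cst.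
exact: (Ck_complin (cpsi j) oA Cg).
Qed.
End bilin.

Lemma is_diff_mulmx U m n p (f df : U -> 'M[R]_(m, n)) (g dg : U -> 'M[R]_(n, p)) x :
  is_diff x f df -> is_diff x g dg ->
  is_diff x (fun y => f y *m g y) (fun v => f x *m dg v + df v *m g x).
Proof.
apply: is_diff_bilin; do ?exact: finite_basis_mx.
  by move=> w a u v; rewrite mulmxDl scalemxAl.
by move=> w a u v; rewrite mulmxDr scalemxAr.
Qed.

Lemma Ck_mulmx U k m n p (A : set U) (f : U -> 'M[R]_(m, n)) (g : U -> 'M[R]_(n, p)) :
  open A -> Ck k A f -> Ck k A g -> Ck k A (fun y => f y *m g y).
Proof.
apply: Ck_bilin; do ?exact: finite_basis_mx.
  by move=> w a u v; rewrite mulmxDl scalemxAl.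
by move=> w a u v; rewrite mulmxDr scalemxAr.
Qed.

Lemma differentiable_mxP U m n (f : U -> 'M[R]_(m, n)) x :
  differentiable f x <-> forall i j, differentiable (fun y => f y i j : R^o) x.
Proof.
split=> [df i j|dfij].
  have -> : (fun y => f y i j : R^o) = (fun M : 'M[R]_(m, n) => M i j : R^o) \o f by [].
  by apply: differentiable_comp => //; exact: differentiable_coord.
have [] // := @is_diff_mx _ _ _ _ f
  (fun v => \matrix_(i, j) 'd (fun y => f y i j : R^o) x v) x _.
move=> i j; apply: DiffDef => //; apply/funext => v; by rewrite mxE.
Qed.

Lemma differentiable_det U n (f : U -> 'M[R]_n) x :
  differentiable f x -> differentiable (fun y => \det (f y) : R^o) x.
Proof.
move=> /differentiable_mxP df; rewrite /determinant.
have dprod (r : seq 'I_n) (s : 'I_n -> 'I_n) :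
    differentiable (fun y => \prod_(i <- r) f y i (s i) : R^o) x.
  elim: r => [|i r IH].
    under [X in differentiable X _]funext do rewrite big_nil.
    exact: differentiable_cst.
  under [X in differentiable X _]funext do rewrite big_cons.
  by apply: differentiableM => //; exact: df.
have dterm (a : R) (s : 'I_n -> 'I_n) : differentiable
    (fun y => a * \prod_i f y i (s i) : R^o) x.
  exact: differentiableM (differentiable_cst _ _) (dprod _ _).
by have [] := is_diff_sum (index_enum _)
  (fun s : {perm 'I_n} => differentiableP (dterm ((-1) ^+ s) s)).
Qed.

(** The adjugate formula holds for [invmx] only on invertible matrices, since elsewhere it returns
    its argument; hence invertibility is asked near [x]. *)
Lemma differentiable_invmx U n (f : U -> 'M[R]_n) x :
  (\forall y \near x, f y \in unitmx) -> differentiable f x ->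
  differentiable (fun y => invmx (f y)) x.
Proof.
move=> fU df.
have dadj : differentiable (fun y => \adj (f y)) x.
  apply/differentiable_mxP => i j.
  under [X in differentiable X _]funext do rewrite mxE.
  apply: differentiableM (differentiable_cst _ _) _.
  apply: differentiable_det; apply/differentiable_mxP => k l.
  under [X in differentiable X _]funext do rewrite !mxE.
  exact: (differentiable_mxP _ _).1.
have ddet := differentiable_det df.
have det0 : \det (f x) != 0.
  by have := nbhs_singleton fU; rewrite unitmxE unitfE.
have [dV _] := is_diff_scale (differentiableP (differentiableV ddet det0))
  (differentiableP dadj).
apply: near_eq_diff dV; apply: filterS fU => y fy.
by rewrite /invmx fy.
Qed.

Lemma slice1 V W X (f : V * W -> X) y x : differentiable f (y, x) ->
  is_diff y (fun z => f (z, x)) (fun v => 'D_(v, 0) f (y, x)).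
Proof.
move=> df.
have di : is_diff y (fun z : V => (z, x)) (fun v => (v, 0)).
  by apply: is_diff_pair; exact: is_diff_cst.
apply: is_diff_eq (is_diff_comp di (differentiableP df)) _.
by apply/funext => v; rewrite deriveE.
Qed.

Lemma slice2 V W X (f : V * W -> X) y x : differentiable f (y, x) ->
  is_diff x (fun z => f (y, z)) (fun v => 'D_(0, v) f (y, x)).
Proof.
move=> df.
have di : is_diff x (fun z : W => (y, z)) (fun v => (0, v)).
  by apply: is_diff_pair; exact: is_diff_cst.
apply: is_diff_eq (is_diff_comp di (differentiableP df)) _.
by apply/funext => v; rewrite deriveE.
Qed.

Lemma Ck_schwarz_mx V m n (A : set V) (f : V -> 'M[R]_(m, n)) x u v :
  open A -> A x -> Ck 2 A f -> 'D_u ('D_v f) x = 'D_v ('D_u f) x.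
Proof.
move=> oA Ax Cf; have [df Df] := Cf.
have ddE w w' i j :
    ('D_w ('D_w' f) x) i j = 'D_w ('D_w' (fun y => f y i j : R^o)) x.
  rewrite derive_mx; last exact/diff_derivable/(Df w').1.
  rewrite mxE; apply: near_eq_derive.
  apply: filterS (open_nbhs_nbhs (conj oA Ax)) => y Ay.
  by rewrite derive_mx ?mxE //; exact/diff_derivable/df.
apply/matrixP => i j.
apply: etrans (ddE u v i j) _.
apply: etrans _ (esym (ddE v u i j)).
exact: (Ck_schwarz _ _ oA Ax (Ck_coord i j oA Cf)).
Qed.

End Bilinear.

(** * Maps read in charts *)

Section ChartDiff.
Variable R : realType.

(** The domain condition cannot be dropped in favour of continuity of the expression in charts,
    because the values of [d] off its domain are arbitrary. It is what lets two such expressions be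
    composed. *)
Definition chart_differentiable (M N : Type) (E F : normedModType R)
    (c : chart M E) (d : chart N F) (f : M -> N) (p : M) : Prop :=
  (\forall x \near c p, dom d (f (cinv c x))) /\
  differentiable (d \o f \o cinv c) (c p).

(** [tmap] for arbitrary charts instead of the preferred ones; for [f = id] it is the differential
    of the transition map, which changes the representation of a tangent vector. *)
Definition chart_diff (M N : Type) (E F : normedModType R)
    (c : chart M E) (d : chart N F) (f : M -> N) (p : M) : E -> F :=
  'd (d \o f \o cinv c) (c p).

Lemma chart_diff_comp (M N P : Type) (E F K : normedModType R)
    (c : chart M E) (b : chart N F) (d : chart P K) f h p :
  cinv c (c p) = p -> {in dom b, cancel b (cinv b)} ->
  chart_differentiable c b f p -> chart_differentiable b d h (f p) ->
  chart_differentiable c d (h \o f) p /\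
  forall v, chart_diff c d (h \o f) p v = chart_diff b d h (f p) (chart_diff c b f p v).
Proof.
move=> cp bK [nf df] [nh dh].
pose k := (d \o h \o cinv b) \o (b \o f \o cinv c).
have bfp : (b \o f \o cinv c) (c p) = b (f p) by rewrite /= cp.
have kE : \forall x \near c p, k x = (d \o (h \o f) \o cinv c) x.
  by apply: filterS nf => x fx; rewrite /k /= bK // inE.
have dk : is_diff (c p) k (
    'd (d \o h \o cinv b) (b (f p)) \o 'd (b \o f \o cinv c) (c p)).
  apply: is_diff_comp; first exact: differentiableP.
  by rewrite bfp; exact: differentiableP.
have [dk' dE] := near_eq_is_diff kE dk.
split; last by move=> v; rewrite /chart_diff dE.
split => //.
have cf := differentiable_continuous df.
have nh' : \forall x \near c p, dom d (h (cinv b (b (f (cinv c x))))).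
  by rewrite -bfp in nh; exact: (cf _ nh).
by apply: filterS2 nf nh' => x fx; rewrite bK ?inE.
Qed.

Lemma chart_diff_linear (M N : Type) (E F : normedModType R)
    (c : chart M E) (d : chart N F) f p : linear (chart_diff c d f p).
Proof. by move=> a u v; rewrite /chart_diff linearP. Qed.

Lemma eq_chart_diff (M N : Type) (E F : normedModType R)
    (c : chart M E) (d : chart N F) f g p : f =1 g ->
  chart_diff c d f p = chart_diff c d g p.
Proof. by move=> /funext ->. Qed.

Lemma chart_diff_id (M : Type) (E : normedModType R) (c : chart M E) p v :
  (\forall x \near c p, c (cinv c x) = x) -> chart_diff c c id p v = v.
Proof.
move=> cK; have [_ dE] := near_eq_is_diff (f := id) (filterS (fun x => @esym _ _ _) cK)
  (is_diff_id (c p)).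
by rewrite /chart_diff dE.
Qed.

Lemma open_preimage_cont (V W : topologicalType) (A : set V) (B : set W) (f : V -> W) :
  open A -> open B -> (forall x, A x -> {for x, continuous f}) ->
  open (A `&` f @^-1` B).
Proof.
move=> oA oB cf; rewrite openE => x [Ax Bfx].
apply: filterI; first exact: open_nbhs_nbhs.
by apply: (cf _ Ax); exact: open_nbhs_nbhs.
Qed.

Lemma near_slice1 (V W : topologicalType) (U : set (V * W)) (y : V) (x : W) :
  nbhs (y, x) U -> \forall z \near y, U (z, x).
Proof.
move=> nU; have c : {for y, continuous (fun z : V => (z, x) : (V * W)%type)}.
  by apply: cvg_pair; [exact: cvg_id|exact: cvg_cst].
exact: c.
Qed.

Lemma near_slice2 (V W : topologicalType) (U : set (V * W)) (y : V) (x : W) :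
  nbhs (y, x) U -> \forall z \near x, U (y, z).
Proof.
move=> nU; have c : {for x, continuous (fun z : W => (y, z) : (V * W)%type)}.
  by apply: cvg_pair; [exact: cvg_cst|exact: cvg_id].
exact: c.
Qed.

End ChartDiff.

Definition vec_chart (R : realType) (V : normedModType R) : chart V V :=
  Chart setT id id.

Section LieCharts.
Variables (R : realType) (n : nat) (G : lieGroup R n).
Notation E := 'rV[R]_n.
Notation AG := (lie_charted G).
Notation mfd := (lie_manifold G).

Lemma lie_chartK c (p : G) : atlas AG c -> dom c p -> cinv c (c p) = p.
Proof. by move=> Ac cp; rewrite (chartK (mfd_chart mfd Ac)) // inE. Qed.

Lemma lie_cinvK c x : atlas AG c -> (c @` dom c) x ->
  dom c (cinv c x) /\ c (cinv c x) = x.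
Proof. by move=> Ac [p cp <-]; rewrite lie_chartK. Qed.

Lemma lie_img_open c : atlas AG c -> open (c @` dom c).
Proof. by move=> /(mfd_chart mfd)/img_open. Qed.

Lemma near_img c (p : G) : atlas AG c -> dom c p ->
  \forall x \near c p, (c @` dom c) x.
Proof.
by move=> Ac cp; apply: open_nbhs_nbhs; split; [exact: lie_img_open|exists p].
Qed.

Lemma trans_open c d : atlas AG c -> atlas AG d -> open (c @` (dom c `&` dom d)).
Proof.
move=> Ac Ad.
have -> : c @` (dom c `&` dom d) = (c @` dom c) `&` cinv c @^-1` dom d.
  apply/seteqP; split=> x.
    by move=> [p [cp dp] <-]; split; [exists p|rewrite /= lie_chartK].
  by move=> [[p cp <-]] /=; rewrite lie_chartK // => dp; exists p.
apply: open_preimage_cont; first exact: lie_img_open.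
  exact: dom_open (mfd_chart mfd Ad).
move=> x cx; have := cinv_cont (mfd_chart mfd Ac).
rewrite continuous_open_subspace; last exact: lie_img_open.
by apply; rewrite inE.
Qed.

Lemma trans_differentiable c d (p : G) : atlas AG c -> atlas AG d ->
  dom c p -> dom d p -> chart_differentiable c d id p.
Proof.
move=> Ac Ad cp dp.
have oT := trans_open Ac Ad.
have Tp : (c @` (dom c `&` dom d)) (c p) by exists p.
split; last exact: (mfd_smooth mfd Ac Ad 1%N).1 Tp.
apply: filterS (open_nbhs_nbhs (conj oT Tp)) => x [q [cq dq] <-].
by rewrite lie_chartK.
Qed.

Lemma chart_diff_trans c d b (p : G) v : atlas AG c -> atlas AG d -> atlas AG b ->
  dom c p -> dom d p -> dom b p ->
  chart_diff d b id p (chart_diff c d id p v) = chart_diff c b id p v.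
Proof.
move=> Ac Ad Ab cp dp bp; have cpK := lie_chartK Ac cp.
have [_ <-] // := chart_diff_comp cpK (chartK (mfd_chart mfd Ad))
  (trans_differentiable Ac Ad cp dp) (trans_differentiable Ad Ab dp bp).
Qed.

Lemma chart_diff_refl c (p : G) v : atlas AG c -> dom c p ->
  chart_diff c c id p v = v.
Proof.
move=> Ac cp; apply: chart_diff_id; apply: filterS (near_img Ac cp) => x cx.
by case: (lie_cinvK Ac cx).
Qed.

Lemma mul_smooth b c d (h g : G) : atlas AG b -> atlas AG c -> atlas AG d ->
  dom b h -> dom c g -> dom d (h * g)%g ->
  exists U : set (E * E), [/\ open U, U (b h, c g),
    forall y, U y -> [/\ (b @` dom b) y.1, (c @` dom c) y.2 &
                        dom d (cinv b y.1 * cinv c y.2)%g] &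
    smooth_on U (fun y => d (cinv b y.1 * cinv c y.2)%g : E)].
Proof.
move=> Ab Ac Ad bh cg dhg.
have Abc : atlas (prod_charted AG AG) (prod_chart b c) by exists b => //; exists c.
have bchg : dom (prod_chart b c) (h, g) by [].
have [U [oU Up Usub Ud sU]] := lie_mul Abc bchg Ad dhg.
exists U; split => // y Uy; split.
- by have [[h' g'] [bh' _] <-] := Usub _ Uy; exists h'.
- by have [[h' g'] [_ cg'] <-] := Usub _ Uy; exists g'.
- by apply: Ud; exists (cinv b y.1, cinv c y.2) => //; exists y.
Qed.

Lemma mulr_differentiable b d (h g : G) : atlas AG b -> atlas AG d ->
  dom b h -> dom d (h * g)%g ->
  chart_differentiable b d (fun x : G => x * g)%g h.
Proof.
move=> Ab Ad bh dhg.
pose c := chart_at AG g.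
have Ac : atlas AG c by exact: mfd_chart_at mfd g.
have cg : dom c g by exact: mfd_dom mfd g.
have [U [oU Up Usub /(_ 1%N)[sU _]]] := mul_smooth Ab Ac Ad bh cg dhg.
have [df _] := slice1 (sU _ Up).
have nU := near_slice1 (open_nbhs_nbhs (conj oU Up)).
split; first by apply: filterS nU => x /Usub[_ _]; rewrite /= lie_chartK.
by rewrite /= lie_chartK in df.
Qed.

Lemma mull_differentiable b d (h g : G) : atlas AG b -> atlas AG d ->
  dom b h -> dom d (g * h)%g ->
  chart_differentiable b d (fun x : G => g * x)%g h.
Proof.
move=> Ab Ad bh dhg.
pose c := chart_at AG g.
have Ac : atlas AG c by exact: mfd_chart_at mfd g.
have cg : dom c g by exact: mfd_dom mfd g.
have [U [oU Up Usub /(_ 1%N)[sU _]]] := mul_smooth Ac Ab Ad cg bh dhg.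
have [df _] := slice2 (sU _ Up).
have nU := near_slice2 (open_nbhs_nbhs (conj oU Up)).
split; first by apply: filterS nU => x /Usub[_ _]; rewrite /= lie_chartK.
by rewrite /= lie_chartK in df.
Qed.

Lemma conj_differentiable b d (h g : G) : atlas AG b -> atlas AG d ->
  dom b h -> dom d (g * h * g^-1)%g ->
  chart_differentiable b d (fun x : G => g * x * g^-1)%g h.
Proof.
move=> Ab Ad bh dh.
pose c := chart_at AG (g * h)%g.
have Ac : atlas AG c by exact: mfd_chart_at mfd _.
have cg : dom c (g * h)%g by exact: mfd_dom mfd _.
by have [] := chart_diff_comp (lie_chartK Ab bh) (chartK (mfd_chart mfd Ac))
  (mull_differentiable Ab Ac bh cg) (mulr_differentiable (h := (g * h)%g) Ac Ad cg dh).
Qed.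

End LieCharts.

(** * Multiplication and invariant vector fields in charts *)

Section LieLocal.
Variables (R : realType) (n : nat) (G : lieGroup R n).
Notation E := 'rV[R]_n.
Notation AG := (lie_charted G).
Notation mfd := (lie_manifold G).
Notation c1 := (chart_at AG 1%g).
Notation e0 := (c1 1%g).

Lemma atlas1 : atlas AG c1. Proof. exact: mfd_chart_at mfd 1%g. Qed.
Lemma dom1 : dom c1 1%g. Proof. exact: mfd_dom mfd 1%g. Qed.
Lemma atlas_at g : atlas AG (chart_at AG g). Proof. exact: mfd_chart_at mfd g. Qed.
Lemma dom_at g : dom (chart_at AG g) g. Proof. exact: mfd_dom mfd g. Qed.

Lemma cinv1 : cinv c1 e0 = 1%g. Proof. exact: lie_chartK atlas1 dom1. Qed.

(** One chart [c] can serve both the second factor and the product because the first factor stays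
    near the identity. *)
Definition mul_rep (c : chart G E) (p : E * E) : E := c (cinv c1 p.1 * cinv c p.2)%g.

(* x |-> rfield c x eta is the right invariant vector field generated by eta, read
   in the chart c, and x |-> lfield x eta the left invariant one, read in c1. *)
Definition rfield (c : chart G E) (x eta : E) : E := 'D_(eta, 0) (mul_rep c) (e0, x).

Definition lfield (x eta : E) : E := 'D_(0, eta) (mul_rep c1) (x, e0).

Lemma mul_rep_smooth c g : atlas AG c -> dom c g ->
  exists U : set (E * E), [/\ open U, U (e0, c g),
    forall y, U y -> [/\ (c1 @` dom c1) y.1, (c @` dom c) y.2 &
                        dom c (cinv c1 y.1 * cinv c y.2)%g] &
    smooth_on U (mul_rep c)].
Proof.
move=> Ac cg; apply: (mul_smooth atlas1 Ac Ac dom1 cg).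
by rewrite mul1g.
Qed.

Lemma mul_rep_differentiable c g : atlas AG c -> dom c g ->
  differentiable (mul_rep c) (e0, c g).
Proof.
move=> Ac cg; have [U [_ Up _ /(_ 1%N)[sU _]]] := mul_rep_smooth Ac cg.
exact: sU.
Qed.

Lemma rfield_chart_diff c g eta : atlas AG c -> dom c g ->
  rfield c (c g) eta = chart_diff c1 c (fun h : G => h * g)%g 1%g eta.
Proof.
move=> Ac cg; have [_ sE] := slice1 (mul_rep_differentiable Ac cg).
rewrite /rfield -[LHS]/((fun v => 'D_(v, 0) (mul_rep c) (e0, c g)) eta) -sE.
by rewrite /chart_diff /mul_rep /= lie_chartK.
Qed.

Lemma lfield_chart_diff g eta : dom c1 g ->
  lfield (c1 g) eta = chart_diff c1 c1 (fun h : G => g * h)%g 1%g eta.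
Proof.
move=> cg.
have [|U [_ Up _ /(_ 1%N)[sU _]]] := mul_smooth atlas1 atlas1 atlas1 cg dom1.
  by rewrite mulg1.
have [_ sE] := slice2 (sU _ Up).
rewrite /lfield -[LHS]/((fun v => 'D_(0, v) (mul_rep c1) (c1 g, e0)) eta) -sE.
by rewrite /chart_diff /mul_rep /= (lie_chartK atlas1).
Qed.

Lemma TeR_chart_diff g eta :
  TeR g eta = chart_diff c1 (chart_at AG g) (fun h : G => h * g)%g 1%g eta.
Proof. by rewrite /TeR /tmap /chart_diff /= mul1g. Qed.

Lemma Ad_chart_diff (g : G) eta :
  Ad g eta = chart_diff c1 c1 (fun h : G => g * h * g^-1)%g 1%g eta.
Proof. by rewrite /Ad /tmap /chart_diff /= mulg1 mulgV. Qed.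

Lemma TeR_linear (g : G) : linear (TeR g).
Proof. by move=> a u v; rewrite !TeR_chart_diff chart_diff_linear. Qed.

Lemma Ad_linear (g : G) : linear (Ad g).
Proof. by move=> a u v; rewrite !Ad_chart_diff chart_diff_linear. Qed.

(** The bridge between the pointwise trivialization of the definitions and a field on a fixed chart,
    which can be differentiated in the point. *)
Lemma rfield_TeR c g eta : atlas AG c -> dom c g ->
  rfield c (c g) eta = chart_diff (chart_at AG g) c id g (TeR g eta).
Proof.
move=> Ac cg; rewrite rfield_chart_diff // TeR_chart_diff.
have bK := chartK (mfd_chart mfd (atlas_at g)).
have r : chart_differentiable c1 (chart_at AG g) (fun h : G => h * g)%g 1%g.
  by apply: mulr_differentiable; rewrite ?mul1g;
     [exact: atlas1|exact: atlas_at|exact: dom1|exact: dom_at].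
have t : chart_differentiable (chart_at AG g) c id (1 * g)%g.
  by rewrite mul1g; apply: trans_differentiable; [exact: atlas_at| |exact: dom_at|].
by have [_ ->] := chart_diff_comp cinv1 bK r t; rewrite mul1g.
Qed.

Lemma rfield_linear c g : atlas AG c -> dom c g -> linear (rfield c (c g)).
Proof.
by move=> Ac cg a u v; rewrite !rfield_chart_diff // chart_diff_linear.
Qed.

Lemma lfield_linear g : dom c1 g -> linear (lfield (c1 g)).
Proof.
by move=> cg a u v; rewrite !lfield_chart_diff // chart_diff_linear.
Qed.

Lemma rfield_e0 eta : rfield c1 e0 eta = eta.
Proof.
rewrite rfield_chart_diff; [|exact: atlas1|exact: dom1].
rewrite (eq_chart_diff _ _ _ (g := id)); last by move=> h; rewrite /= mulg1.
by apply: chart_diff_refl; [exact: atlas1|exact: dom1].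
Qed.

Lemma lfield_e0 eta : lfield e0 eta = eta.
Proof.
rewrite lfield_chart_diff; last exact: dom1.
rewrite (eq_chart_diff _ _ _ (g := id)); last by move=> h; rewrite /= mul1g.
by apply: chart_diff_refl; [exact: atlas1|exact: dom1].
Qed.

Lemma mul_lin1_linear m (f : E -> 'rV[R]_m) u : linear f -> u *m lin1_mx f = f u.
Proof.
move=> lf; pose F : {linear E -> 'rV[R]_m} :=
  HB.pack f (GRing.isLinear.Build _ _ _ _ _ lf).
exact: (mul_rV_lin1 F).
Qed.

Lemma eq_lin1_mx (f g : E -> E) : f =1 g -> lin1_mx f = lin1_mx g.
Proof. by move=> /funext ->. Qed.

Lemma lin1_mx_comp (f g : E -> E) : linear f -> linear g ->
  lin1_mx f *m lin1_mx g = lin1_mx (g \o f).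
Proof.
move=> lf lg; have lgf : linear (g \o f) by move=> a u v /=; rewrite lf lg.
by apply/row_matrixP => i; rewrite row_mul !rowE !mul_lin1_linear.
Qed.

Lemma lin1_mx_id m : lin1_mx id = 1%:M :> 'M[R]_m.
Proof. by apply/matrixP => i j; rewrite !mxE eqxx eq_sym. Qed.

Lemma lin1_chart_diff_trans c d b (p : G) : atlas AG c -> atlas AG d -> atlas AG b ->
  dom c p -> dom d p -> dom b p ->
  lin1_mx (chart_diff c d id p) *m lin1_mx (chart_diff d b id p) =
  lin1_mx (chart_diff c b id p).
Proof.
move=> Ac Ad Ab cp dp bp.
apply: etrans (lin1_mx_comp _ _) _; do ?exact: chart_diff_linear.
by apply: eq_lin1_mx => v; exact: chart_diff_trans.
Qed.

Lemma lin1_chart_diff_refl c (p : G) : atlas AG c -> dom c p ->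
  lin1_mx (chart_diff c c id p) = 1%:M.
Proof.
move=> Ac cp; apply: etrans (eq_lin1_mx (g := id) _) (lin1_mx_id _).
by move=> v; exact: chart_diff_refl.
Qed.

(** As vectors are rows and covectors are columns, this one matrix acts on the right of a row as
    rho_x and on the left of a column as its dual. *)
Definition rmx (c : chart G E) (x : E) : 'M[R]_n := lin1_mx (rfield c x).

Lemma rmx_TeR c (h : G) : atlas AG c -> dom c h ->
  rmx c (c h) = lin1_mx (TeR h) *m lin1_mx (chart_diff (chart_at AG h) c id h).
Proof.
move=> Ac ch; apply: esym; apply: etrans (lin1_mx_comp _ _) _.
- exact: TeR_linear.
- exact: chart_diff_linear.
by apply: eq_lin1_mx => v; apply: esym; exact: rfield_TeR.
Qed.

Lemma rmx_unit c g : atlas AG c -> dom c g -> rmx c (c g) \in unitmx.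
Proof.
move=> Ac cg; rewrite rmx_TeR // unitmx_mul; apply/andP; split.
  exact: TeR_unitmx.
have fk := lin1_chart_diff_trans (atlas_at g) Ac (atlas_at g) (dom_at g) cg (dom_at g).
case: (mulmx1_unit (etrans fk (lin1_chart_diff_refl (atlas_at g) (dom_at g)))) => uc _.
exact: uc.
Qed.

Lemma open_slice2 (V W : topologicalType) (U : set (V * W)) (y : V) :
  open U -> open [set z | U (y, z)].
Proof.
by move=> oU; rewrite openE => z Uz; apply: near_slice2; exact: open_nbhs_nbhs.
Qed.

Lemma Ck_slice2 (V W X : normedModType R) k (U : set (V * W)) (f : V * W -> X) y :
  finite_basis V -> finite_basis W -> open U ->
  Ck k U f -> Ck k [set z | U (y, z)] (fun z => f (y, z)).
Proof.
move=> fV fW oU Cf; have oV := open_slice2 y oU.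
apply: (@Ck_comp R W (V * W)%type X k _ U (fun z => (y, z)) f) => //.
  exact: finite_basis_prod.
by apply: Ck_pair => //; [exact: Ck_cst|exact: Ck_id].
Qed.

Lemma rfield_smooth c eta : atlas AG c ->
  smooth_on (c @` dom c) (fun x => rfield c x eta).
Proof.
move=> Ac k; apply: Ck_cover => x [g cg <-].
have [U [oU Up _ sU]] := mul_rep_smooth Ac cg.
exists [set z | U (e0, z)] => //.
(* The derivative along [eta] costs one order of smoothness. *)
have [_ /(_ (eta, 0)) CD] := sU k.+1.
exact: (Ck_slice2 e0 (finite_basis_mx _ _ _) (finite_basis_mx _ _ _) oU CD).
Qed.

Lemma rfield_differentiable c g eta : atlas AG c -> dom c g ->
  differentiable (fun x => rfield c x eta) (c g).
Proof.
by move=> Ac cg; have [+ _] := rfield_smooth eta Ac 1%N; apply; exists g.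
Qed.

Lemma lfield_differentiable eta : differentiable (fun x => lfield x eta) e0.
Proof.
have [U [oU Up _ sU]] := mul_rep_smooth atlas1 dom1.
have [_ /(_ (0, eta)) [CD _]] := sU 2%N.
by have [] := slice1 (CD _ Up).
Qed.

End LieLocal.

(** * The Lie bracket and the adjoint action *)

Section LieBracket.
Variables (R : realType) (n : nat) (G : lieGroup R n).
Notation E := 'rV[R]_n.
Notation AG := (lie_charted G).
Notation mfd := (lie_manifold G).
Notation c1 := (chart_at AG 1%g).
Notation e0 := (c1 1%g).

Lemma derive_is_diff (W : normedModType R) (f : R -> W) t v :
  is_derive t (1 : R) f v -> is_diff t f ( *:%R ^~ v).
Proof.
move=> [/derivable1_diffP df dv]; apply: DiffDef => //; apply/funext => r.
by rewrite -dv deriveE // -linearZ /= [_ *: _]mulr1.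
Qed.

Lemma diff_derive1 (W : normedModType R) (f : R -> W) df t v :
  is_diff t f df -> df 1 = v -> is_derive t (1 : R) f v.
Proof. by move=> dff <-; exact: diff_is_derive. Qed.

Lemma lie_chart_diff_comp (c b d : chart G E) (f h k : G -> G) p q v :
  atlas AG c -> atlas AG b -> dom c p -> f p = q -> h \o f =1 k ->
  chart_differentiable c b f p -> chart_differentiable b d h q ->
  chart_diff c d k p v = chart_diff b d h q (chart_diff c b f p v).
Proof.
move=> Ac Ab cp fp /funext <- df; rewrite -fp => dh.
by have [_ ->] := chart_diff_comp (lie_chartK Ac cp) (chartK (mfd_chart mfd Ab)) df dh.
Qed.

(** The identity g h = (g h g^-1) g, differentiated at h = 1. It expresses [Ad] through derivatives
    of the multiplication alone. *)
Lemma rfield_Ad g eta : dom c1 g ->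
  rfield c1 (c1 g) (Ad g eta) = lfield G (c1 g) eta.
Proof.
move=> cg; have A1 := atlas1 G; have d1 := dom1 G.
rewrite rfield_chart_diff // lfield_chart_diff // Ad_chart_diff.
have conj1 : (g * 1 * g^-1)%g = 1%g :> G by rewrite mulg1 mulgV.
apply: esym; apply: lie_chart_diff_comp => //.
- by move=> h /=; rewrite mulgVK.
- by apply: conj_differentiable => //; rewrite conj1.
- by apply: mulr_differentiable => //; rewrite mul1g.
Qed.

Lemma Ad1 eta : Ad (1%g : G) eta = eta.
Proof.
rewrite Ad_chart_diff (eq_chart_diff _ _ _ (g := id)).
  by apply: chart_diff_refl; [exact: atlas1|exact: dom1].
by move=> h; rewrite mul1g invg1 mulg1.
Qed.

Lemma AdM (g h : G) eta : Ad (g * h)%g eta = Ad g (Ad h eta).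
Proof.
rewrite !Ad_chart_diff; have A1 := atlas1 G; have d1 := dom1 G.
have conj1 k : (k * 1 * k^-1)%g = 1%g :> G by rewrite mulg1 mulgV.
apply: lie_chart_diff_comp => //.
- by move=> k; rewrite /= invgM !mulgA.
- by apply: conj_differentiable => //; rewrite conj1.
- by apply: conj_differentiable => //; rewrite conj1.
Qed.

Lemma rmx_differentiable c g : atlas AG c -> dom c g ->
  differentiable (rmx c) (c g).
Proof.
move=> Ac cg; apply/differentiable_mxP => i j.
under [X in differentiable X _]funext do rewrite mxE.
exact: (differentiable_mxP _ _).1 (rfield_differentiable _ Ac cg) _ _.
Qed.

Lemma near_rmx_unit c g : atlas AG c -> dom c g ->
  \forall x \near c g, rmx c x \in unitmx.
Proof.
move=> Ac cg; apply: filterS (near_img Ac cg) => _ [h ch <-].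
exact: rmx_unit.
Qed.

Lemma near_rmxE c g eta : atlas AG c -> dom c g ->
  \forall x \near c g, eta *m rmx c x = rfield c x eta.
Proof.
move=> Ac cg; apply: filterS (near_img Ac cg) => _ [h ch <-].
by apply: mul_lin1_linear; exact: rfield_linear.
Qed.

(* Second derivative of the multiplication at (1, 1), in xi for the first factor
   and in eta for the second one. *)
Definition lderiv (xi eta : E) : E := 'D_xi (fun x => lfield G x eta) e0.

(** The Lie bracket of the group, defined without [exp]; [ad_bracket] identifies it with [ad]. *)
Definition bracket (xi eta : E) : E := lderiv xi eta - lderiv eta xi.

Lemma derive_rfield c g u eta : atlas AG c -> dom c g ->
  'D_u (fun x => rfield c x eta) (c g) =
  'D_(eta, 0) ('D_(0, u) (mul_rep c)) (e0, c g).
Proof.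
move=> Ac cg; have [U [oU Up _ sU]] := mul_rep_smooth Ac cg.
have [_ /(_ (eta, 0)) [CD _]] := sU 2%N.
have [_ sE] := slice2 (CD _ Up).
have [df _] := rfield_smooth eta Ac 1%N.
rewrite deriveE; last by apply: df; exists g.
rewrite [LHS](congr1 (fun k => k u) sE).
exact: (Ck_schwarz_mx _ _ oU Up (sU 2%N)).
Qed.

(** By symmetry of second derivatives, differentiating the right invariant field of [eta] along [u]
    amounts to differentiating the left invariant field of [u] along [eta]. *)
Lemma derive_rfield1 u eta : 'D_u (fun x => rfield c1 x eta) e0 = lderiv eta u.
Proof.
rewrite derive_rfield; [|exact: atlas1|exact: dom1].
have [U [oU Up _ sU]] := mul_rep_smooth (atlas1 G) (dom1 G).
have [_ /(_ (0, u)) [CD _]] := sU 2%N.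
have [_ sE] := slice1 (CD _ Up).
apply: etrans _ (esym (deriveE _ (lfield_differentiable G u))).
exact: esym (congr1 (fun k => k eta) sE).
Qed.

Lemma solve_product_rule (a b q l r : E) (M N : 'M[R]_n) :
  a = b -> M = 1%:M -> a *m N + q *m M = l -> b *m N + 0 *m M = r -> q = l - r.
Proof.
by move=> -> -> <- <-; rewrite mulmx1 mul0mx addr0 addrC addKr.
Qed.

(** [Ad] is itself a differential, so its regularity in the group element has to be derived: solving
    [rfield_Ad] for it, by inverting rho_x, gives differentiability. The product rule at [e0] then
    yields the value as a difference of two [lderiv] terms. *)
Lemma is_diff_Ad eta :
  is_diff e0 (fun x => Ad (cinv c1 x) eta) (bracket ^~ eta).
Proof.
have A1 := atlas1 G; have d1 := dom1 G.
pose A x := Ad (cinv c1 x) eta.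
have nA : \forall x \near e0, A x *m rmx c1 x = lfield G x eta.
  apply: filterS (near_img A1 d1) => _ [g cg <-].
  apply: etrans (mul_lin1_linear _ (rfield_linear A1 cg)) _.
  have -> : A (c1 g) = Ad g eta by rewrite /A lie_chartK.
  exact: rfield_Ad.
have dM := rmx_differentiable A1 d1.
have dl := lfield_differentiable G eta.
have dA : differentiable A e0.
  have dI := differentiable_invmx (near_rmx_unit A1 d1) dM.
  have [dlI _] := is_diff_mulmx (differentiableP dl) (differentiableP dI).
  apply: near_eq_diff dlI; apply: filterS2 nA (near_rmx_unit A1 d1) => x <- ux.
  by rewrite mulmxK.
have M0 : rmx c1 e0 = 1%:M.
  apply/row_matrixP => i; rewrite !rowE mulmx1.
  exact: etrans (mul_lin1_linear _ (rfield_linear A1 d1)) (rfield_e0 _ _).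
have A0 : A e0 = eta by rewrite /A cinv1 Ad1.
(* Product rule for (A x) rho_x = lfield x eta, where rho_e0 = 1. *)
have E1 := near_eq_is_diff nA (is_diff_mulmx (differentiableP dA) (differentiableP dM)).
have E2 v := is_diff_uniq E1 (differentiableP dl) v.
have E3 := near_eq_is_diff (near_rmxE eta A1 d1)
  (is_diff_mulmx (is_diff_cst eta e0) (differentiableP dM)).
have E4 v := is_diff_uniq E3 (differentiableP (rfield_differentiable eta A1 d1)) v.
apply: is_diff_eq (differentiableP dA) _; apply/funext => v.
have h4 : eta *m 'd (rmx c1) e0 v + 0 *m rmx c1 e0 = 'd (fun x => rfield c1 x eta) e0 v.
  by have := E4 v.
have h2 : A e0 *m 'd (rmx c1) e0 v + 'd A e0 v *m rmx c1 e0 =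
    'd (fun x => lfield G x eta) e0 v.
  by have := E2 v.
have r1 : 'd (fun x => rfield c1 x eta) e0 v = lderiv eta v.
  apply: etrans (derive_rfield1 v eta).
  exact: esym (deriveE _ (rfield_differentiable eta A1 d1)).
have l1 : 'd (fun x => lfield G x eta) e0 v = lderiv v eta.
  exact: esym (deriveE _ dl).
rewrite /bracket -r1 -l1; exact: solve_product_rule A0 M0 h2 h4.
Qed.

Lemma lderiv_linearl eta : linear (lderiv ^~ eta).
Proof.
have dl := lfield_differentiable G eta.
by move=> a u v; rewrite /lderiv !deriveE // linearP.
Qed.

Lemma lderiv_linearr xi : linear (lderiv xi).
Proof.
move=> a u v.
have [du dv] := (lfield_differentiable G u, lfield_differentiable G v).
have dau := differentiableZ a du.
have nE : \forall x \near e0, lfield G x (a *: u + v) =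
    (a *: (fun x => lfield G x u) + (fun x => lfield G x v)) x.
  apply: filterS (near_img (atlas1 G) (dom1 G)) => _ [g cg <-].
  exact: lfield_linear.
apply: etrans (near_eq_derive xi nE) _.
apply: etrans (deriveD (@diff_derivable _ _ _ _ _ xi dau)
  (@diff_derivable _ _ _ _ _ xi dv)) _.
apply: (congr1 (+%R^~ (lderiv xi v))).
exact: deriveZ (@diff_derivable _ _ _ _ _ xi du).
Qed.

Lemma linear_combB (V : lmodType R) a (p q r s : V) :
  (a *: p + q) - (a *: r + s) = a *: (p - r) + (q - s).
Proof. by rewrite scalerBr opprD addrACA. Qed.

Lemma linear_combN (V : lmodType R) a (p q : V) :
  - (a *: p + q) = a *: - p + - q.
Proof. by rewrite scalerN opprD. Qed.

Lemma bracket_linearl eta : linear (bracket ^~ eta).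
Proof.
move=> a u v; rewrite /bracket.
have -> : lderiv (a *: u + v) eta = a *: lderiv u eta + lderiv v eta.
  exact: lderiv_linearl.
have -> : lderiv eta (a *: u + v) = a *: lderiv eta u + lderiv eta v.
  exact: lderiv_linearr.
exact: linear_combB.
Qed.

Lemma bracketC xi eta : bracket xi eta = - bracket eta xi.
Proof. by rewrite /bracket opprB. Qed.

Lemma bracket_linearr xi : linear (bracket xi).
Proof.
move=> a u v; rewrite [LHS]bracketC (bracketC xi u) (bracketC xi v).
have -> : bracket (a *: u + v) xi = a *: bracket u xi + bracket v xi.
  exact: bracket_linearl.
exact: linear_combN.
Qed.

Lemma is_derive_Ad (gamma : R -> G) v eta : gamma 0 = 1%g ->
  (\forall s \near 0, dom c1 (gamma s)) ->
  is_derive (0 : R) (1 : R) (c1 \o gamma) v ->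
  is_derive (0 : R) (1 : R) (fun s => Ad (gamma s) eta) (bracket v eta).
Proof.
move=> g0 ng dg.
have dA : is_diff ((c1 \o gamma) 0) (fun x => Ad (cinv c1 x) eta) (bracket ^~ eta).
  by rewrite /= g0; exact: is_diff_Ad.
have dc := is_diff_comp (derive_is_diff dg) dA.
have := diff_derive1 dc erefl; rewrite /= scale1r.
apply: near_eq_is_derive; apply: filterS ng => s ds /=.
by rewrite (lie_chartK (atlas1 G)).
Qed.

End LieBracket.

(** * The Maurer-Cartan equation from associativity *)

Section MaurerCartan.
Variables (R : realType) (n : nat) (G : lieGroup R n).
Notation E := 'rV[R]_n.
Notation AG := (lie_charted G).
Notation c1 := (chart_at AG 1%g).
Notation e0 := (c1 1%g).

Lemma linear_row_sum (V : lmodType R) (f : E -> V) v : linear f ->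
  f v = \sum_i v 0 i *: f (delta_mx 0 i).
Proof.
move=> lf; pose F : {linear E -> V} := HB.pack f (GRing.isLinear.Build _ _ _ _ _ lf).
rewrite [in LHS](row_sum_delta v) -[LHS]/(F _) linear_sum.
by apply: eq_bigr => i _; rewrite linearZ.
Qed.

Lemma derive_fst_linear (V W X : normedModType R) (f : V * W -> X) p :
  differentiable f p -> linear (fun v => 'D_(v, 0) f p).
Proof.
move=> df a u v; rewrite !deriveE // -linearP; congr ('d _ _ _).
by congr pair; rewrite /= scaler0 addr0.
Qed.

Section at_point.
Variables (c : chart G E) (g : G).
Hypotheses (Ac : atlas AG c) (cg : dom c g).
Notation x0 := (c g).
Notation F := (mul_rep c).

Lemma mul_rep1 : F (e0, x0) = x0.
Proof. by rewrite /mul_rep /= cinv1 lie_chartK // mul1g. Qed.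

Lemma mul_repr1 y : (c1 @` dom c1) y -> mul_rep c1 (y, e0) = y.
Proof.
move=> [h ch <-]; rewrite /mul_rep /= cinv1 lie_chartK ?mulg1 //.
exact: atlas1.
Qed.

(* Derivative at y' = e0 of F (y, F (y', x0)) = F (mul_rep c1 (y, y'), x0). *)
Lemma near_mul_rep_assoc zeta : \forall y \near e0,
  'D_(0, rfield c x0 zeta) F (y, x0) = 'D_(lfield G y zeta, 0) F (y, x0).
Proof.
have [U [oU Up Usub sU]] := mul_rep_smooth Ac cg.
have [U1 [oU1 Up1 Usub1 sU1]] := mul_rep_smooth (atlas1 G) (dom1 G).
have nU := near_slice1 (open_nbhs_nbhs (conj oU Up)).
have nU1 := near_slice1 (open_nbhs_nbhs (conj oU1 Up1)).
apply: filterS2 nU nU1 => y Uy U1y.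
pose k1 y' := F (y, F (y', x0)).
pose k2 y' := F (mul_rep c1 (y, y'), x0).
have kE : \forall y' \near e0, k1 y' = k2 y'.
  have nU1y := near_slice2 (open_nbhs_nbhs (conj oU1 U1y)).
  have nU' := near_slice1 (open_nbhs_nbhs (conj oU Up)).
  apply: filterS2 nU' nU1y => y' /Usub[_ _ d1] /Usub1[_ _ d2].
  rewrite /k1 /k2 /mul_rep /=.
  rewrite (lie_chartK Ac d1) (lie_chartK (atlas1 G) d2) mulgA //.
have dk1 : is_diff e0 k1 (fun v => 'D_(0, 'D_(v, 0) F (e0, x0)) F (y, x0)).
  have dF : is_diff (F (e0, x0)) (fun z => F (y, z)) (fun v => 'D_(0, v) F (y, x0)).
    by rewrite mul_rep1; apply: slice2; exact: (sU 1%N).1.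
  exact: is_diff_comp (slice1 ((sU 1%N).1 _ Up)) dF.
have dk2 : is_diff e0 k2 (fun v => 'D_('D_(0, v) (mul_rep c1) (y, e0), 0) F (y, x0)).
  have dF : is_diff (mul_rep c1 (y, e0)) (fun z => F (z, x0))
      (fun v => 'D_(v, 0) F (y, x0)).
    by rewrite mul_repr1; [apply: slice1; exact: (sU 1%N).1|have [] := Usub1 _ U1y].
  exact: is_diff_comp (slice2 ((sU1 1%N).1 _ U1y)) dF.
exact: is_diff_uniq (near_eq_is_diff kE dk1) dk2 zeta.
Qed.

(** Derivative of [near_mul_rep_assoc] at [y = e0] along [eta]. On the right, [y] occurs in the base
    point and in the direction [lfield G y zeta], whence the two terms. *)
Lemma derive_rfield_assoc eta zeta :
  'D_(rfield c x0 zeta) (fun x => rfield c x eta) x0 =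
  'D_(zeta, 0) ('D_(eta, 0) F) (e0, x0) + rfield c x0 (lderiv G eta zeta).
Proof.
have [U [oU Up Usub sU]] := mul_rep_smooth Ac cg.
have nU := near_slice1 (open_nbhs_nbhs (conj oU Up)).
have dD w : differentiable ('D_w F) (e0, x0).
  by have [_ /(_ w) [+ _]] := sU 2%N; exact.
have dl := lfield_differentiable G zeta.
(* Expansion in the basis separates the moving direction from the derivatives of [F] in fixed
   directions, so that the product rule applies. *)
pose k y := \sum_i lfield G y zeta 0 i *: 'D_(delta_mx 0 i, 0) F (y, x0).
have kE : \forall y \near e0, 'D_(0, rfield c x0 zeta) F (y, x0) = k y.
  apply: filterS2 nU (near_mul_rep_assoc zeta) => y Uy ->.
  exact: (linear_row_sum _ (derive_fst_linear ((sU 1%N).1 _ Uy))).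
pose dk v := \sum_i (lfield G e0 zeta 0 i *: 'D_(v, 0) ('D_(delta_mx 0 i, 0) F) (e0, x0)
  + 'd (fun y => lfield G y zeta 0 i : R^o) e0 v *: 'D_(delta_mx 0 i, 0) F (e0, x0)).
have dkE : is_diff e0 k dk.
  have dli i := differentiableP ((differentiable_mxP _ _).1 dl 0 i).
  exact: is_diff_sum (fun i => is_diff_scale (dli i) (slice1 (dD (delta_mx 0 i, 0)))).
have dkeE : 'D_(eta, 0) ('D_(0, rfield c x0 zeta) F) (e0, x0) = dk eta.
  exact: is_diff_uniq
    (near_eq_is_diff kE (slice1 (dD (0, rfield c x0 zeta)))) dkE eta.
apply: etrans (derive_rfield _ _ Ac cg) _.
apply: etrans dkeE _; rewrite /dk big_split; apply: congr2.
  apply: etrans _ (esym (linear_row_sum zeta (derive_fst_linear (dD (eta, 0))))).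
  apply: eq_bigr => i _.
  exact: (congr2 *:%R (congr1 (fun M : E => M 0 i) (lfield_e0 G zeta))
    (Ck_schwarz_mx _ _ oU Up (sU 2%N))).
apply: etrans _ (esym (linear_row_sum _ (rfield_linear Ac cg))).
apply: eq_bigr => i _; apply: (congr1 ( *:%R^~ _)).
have dli j := (differentiable_mxP _ _).1 dl 0 j.
rewrite /lderiv derive_mx; last exact: diff_derivable.
by rewrite mxE deriveE.
Qed.

Lemma sub_of_add (V : zmodType) (x y a b p q : V) :
  x = a + p -> y = b + q -> a = b -> x - y = - (q - p).
Proof. by move=> -> -> ->; rewrite opprD addrACA subrr add0r opprB. Qed.

(** The second derivatives of [F] in the first factor are symmetric and drop out, leaving the
    antisymmetrized [lderiv]. The minus sign is the usual one for commutators of right invariant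
    fields. *)
Lemma maurer_cartan eta zeta :
  'D_(rfield c x0 eta) (fun x => rfield c x zeta) x0 -
  'D_(rfield c x0 zeta) (fun x => rfield c x eta) x0 =
  - rfield c x0 (bracket G eta zeta).
Proof.
have [U [oU Up Usub sU]] := mul_rep_smooth Ac cg.
apply: etrans (sub_of_add (derive_rfield_assoc zeta eta) (derive_rfield_assoc eta zeta)
  (Ck_schwarz_mx _ _ oU Up (sU 2%N))) _.
apply: (congr1 -%R).
have lr := rfield_linear Ac cg.
pose r : {linear E -> E} := HB.pack (rfield c x0) (GRing.isLinear.Build _ _ _ _ _ lr).
exact: esym (linearB r _ _).
Qed.
End at_point.

End MaurerCartan.

(** * Identification of [ad] with the bracket, and the Jacobi identity *)

Section Adjoint.
Variables (R : realType) (n : nat) (G : lieGroup R n).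
Notation E := 'rV[R]_n.
Notation AG := (lie_charted G).
Notation c1 := (chart_at AG 1%g).
Notation e0 := (c1 1%g).
Variables (exp : E -> G) (exp_spec : is_lie_exp exp).

Lemma exp0 xi : exp (0 *: xi) = 1%g.
Proof.
have [_ /(_ 0 0) + _] := exp_spec xi; rewrite addr0 => e1.
by apply: (mulgI (exp (0 *: xi))); rewrite -e1 mulg1.
Qed.

Lemma exp_velocity xi :
  (\forall s \near 0, dom c1 (exp (s *: xi))) /\
  is_derive (0 : R) (1 : R) (c1 \o (fun s => exp (s *: xi))) xi.
Proof. by have [_ _ []] := exp_spec xi; rewrite exp0. Qed.

Lemma ad_bracket xi eta : ad exp xi eta = bracket G xi eta.
Proof.
have [ne de] := exp_velocity xi.
have [_ dE] := is_derive_Ad eta (exp0 xi) ne de.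
by rewrite /ad derive1E dE.
Qed.

(** Derivative at s = 0 of Ad_(g exp(s eta) g^-1) (Ad_g zeta) = Ad_g (Ad_(exp(s eta)) zeta); the
    conjugated curve has velocity [Ad g eta] at the identity. *)
Lemma Ad_bracket (g : G) eta zeta :
  Ad g (bracket G eta zeta) = bracket G (Ad g eta) (Ad g zeta).
Proof.
have [ne de] := exp_velocity eta.
have d1 := is_derive_Ad zeta (exp0 eta) ne de.
pose gam (s : R) := (g * exp (s *: eta) * g^-1)%g.
have A1 := atlas1 G; have dm1 := dom1 G.
have conj1 : (g * 1 * g^-1)%g = 1%g :> G by rewrite mulg1 mulgV.
have [nc dc] : chart_differentiable c1 c1 (fun k : G => g * k * g^-1)%g 1%g.
  by apply: conj_differentiable => //; rewrite conj1.
have dexp := derive_is_diff de.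
have gam0 : gam 0 = 1%g by rewrite /gam exp0.
have ce0 : (c1 \o (fun s : R => exp (s *: eta))) 0 = e0 by rewrite /= exp0.
have ngam : \forall s \near 0, dom c1 (gam s).
  have [/differentiable_continuous ce _] := dexp.
  rewrite -ce0 in nc; have nc' := ce _ nc.
  by apply: filterS2 ne nc' => s ds; rewrite /= (lie_chartK A1).
have dgam : is_derive (0 : R) (1 : R) (c1 \o gam) (Ad g eta).
  have dc' : is_diff ((c1 \o (fun s : R => exp (s *: eta))) 0)
    (c1 \o (fun k : G => g * k * g^-1)%g \o cinv c1)
    (chart_diff c1 c1 (fun k : G => g * k * g^-1)%g 1%g).
    by rewrite ce0; exact: differentiableP.
  have := diff_derive1 (is_diff_comp dexp dc') erefl.
  rewrite /= scale1r Ad_chart_diff; apply: near_eq_is_derive.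
  by apply: filterS ne => s ds; rewrite /= (lie_chartK A1).
have [_ d2] := is_derive_Ad (Ad g zeta) gam0 ngam dgam.
have lA := Ad_linear g.
pose A : {linear E -> E} := HB.pack (Ad g) (GRing.isLinear.Build _ _ _ _ _ lA).
have cA : continuous A.
  have -> : (A : E -> E) = chart_diff c1 c1 (fun k : G => g * k * g^-1)%g 1%g.
    by apply/funext => v; exact: Ad_chart_diff.
  exact: diff_continuous.
have [_ d3] := diff_derive1 (is_diff_complin cA (derive_is_diff d1)) erefl.
move: d2; rewrite (_ : (fun s => _) = fun s => A (Ad (exp (s *: eta)) zeta)).
  by rewrite d3 scale1r; exact.
by apply/funext => s; rewrite -AdM /gam mulgVK AdM.
Qed.

Lemma is_diff_bracket (V : normedModType R) (f df h dh : V -> E) x :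
  is_diff x f df -> is_diff x h dh ->
  is_diff x (fun y => bracket G (f y) (h y))
    (fun v => bracket G (f x) (dh v) + bracket G (df v) (h x)).
Proof.
apply: is_diff_bilin; do ?exact: finite_basis_mx.
- exact: bracket_linearl.
- exact: bracket_linearr.
Qed.

(* Derivative of Ad_bracket along g = exp (s xi) at s = 0. *)
Lemma jacobi xi eta zeta :
  bracket G xi (bracket G eta zeta) =
  bracket G eta (bracket G xi zeta) + bracket G (bracket G xi eta) zeta.
Proof.
have [ne de] := exp_velocity xi.
have dA v := derive_is_diff (is_derive_Ad v (exp0 xi) ne de).
have dB := is_diff_bracket (dA eta) (dA zeta).
have E1 := is_diff_uniq (dA (bracket G eta zeta)).
move: dB; rewrite (_ : (fun y => _) =
    fun s : R => Ad (exp (s *: xi)) (bracket G eta zeta)).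
  move=> dB; have Ad0 v : Ad (exp (0 *: xi)) v = v by rewrite exp0 Ad1.
  apply: etrans (esym (scale1r _)) (etrans (E1 _ dB 1) _).
  apply: (congr2 +%R).
    exact: (congr2 (bracket G) (Ad0 _) (scale1r _)).
  exact: (congr2 (bracket G) (scale1r _) (Ad0 _)).
by apply/funext => s; rewrite Ad_bracket.
Qed.

End Adjoint.

(** * The canonical form in a trivialization *)

Section Liouville.
Variables (R : realType) (n : nat) (G : lieGroup R n).
Notation E := 'rV[R]_n.
Notation gs := 'cV[R]_n.
Notation AG := (lie_charted G).
Notation mfd := (lie_manifold G).

Lemma pairing_linearl (xi : E) : linear (fun mu : gs => pairing mu xi : R^o).
Proof. by move=> a u v; rewrite /pairing mulmxDr -scalemxAr !mxE. Qed.

Lemma pairing_linearr (mu : gs) : linear (fun xi : E => pairing mu xi : R^o).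
Proof. by move=> a u v; rewrite /pairing mulmxDl -scalemxAl !mxE. Qed.

Lemma is_diff_pairing (V : normedModType R) (f df : V -> gs) (h dh : V -> E) x :
  is_diff x f df -> is_diff x h dh ->
  is_diff x (fun y => pairing (f y) (h y) : R^o)
    (fun v => pairing (f x) (dh v) + pairing (df v) (h x)).
Proof.
apply: (is_diff_bilin (b := fun mu xi => pairing mu xi : R^o));
  do ?exact: finite_basis_mx.
- exact: pairing_linearl.
- exact: pairing_linearr.
Qed.

Lemma pairing_dual_map (f : E -> E) (mu : gs) xi : linear f ->
  pairing (dual_map f mu) xi = pairing mu (f xi).
Proof. by move=> lf; rewrite /pairing /dual_map mulmxA mul_lin1_linear. Qed.

Lemma tmap_cinv c (h : G) : atlas AG c -> dom c h ->
  tmap (vec_charted E) AG (cinv c) (c h) = chart_diff c (chart_at AG h) id h.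
Proof. by move=> Ac ch; rewrite /tmap /chart_diff /= lie_chartK. Qed.

Lemma tmap_chart (c : chart G E) (h : G) :
  tmap AG (vec_charted E) c h = chart_diff (chart_at AG h) c id h.
Proof. by []. Qed.

(* 'd is a junk value at points where the map is not differentiable, so the
   cotangent transition maps have to be differentiable for tmap to be meaningful. *)
Lemma cot_trans_differentiable b c (h : G) : atlas AG b -> atlas AG c ->
  dom b h -> dom c h ->
  differentiable (fun z => lin1_mx ('d (c \o cinv b) z)) (b h).
Proof.
move=> Ab Ac bh ch.
have oT := trans_open Ab Ac.
have Tp : (b @` (dom b `&` dom c)) (b h) by exists h.
have [dT DT] := mfd_smooth mfd Ab Ac 2%N.
apply/differentiable_mxP => i j.
have [dD _] := DT (delta_mx 0 i).
apply: near_eq_diff ((differentiable_mxP _ _).1 (dD _ Tp) 0 j).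
apply: filterS (open_nbhs_nbhs (conj oT Tp)) => z Tz.
by rewrite mxE deriveE //; exact: dT.
Qed.

Notation TsM := ((E * gs) * (gs * E))%type.

Lemma is_diff_proj11 (A B C : normedModType R) (Y : (A * B) * C) :
  is_diff Y (fun Y : (A * B) * C => Y.1.1) (fun Y : (A * B) * C => Y.1.1).
Proof. exact: (is_diff_comp (is_diff_fst Y) (is_diff_fst Y.1)). Qed.

Lemma is_diff_proj12 (A B C : normedModType R) (Y : (A * B) * C) :
  is_diff Y (fun Y : (A * B) * C => Y.1.2) (fun Y : (A * B) * C => Y.1.2).
Proof. exact: (is_diff_comp (is_diff_fst Y) (is_diff_snd Y.1)). Qed.

Lemma is_diff_proj21 (A B C : normedModType R) (Y : A * (B * C)) :
  is_diff Y (fun Y : A * (B * C) => Y.2.1) (fun Y : A * (B * C) => Y.2.1).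
Proof. exact: (is_diff_comp (is_diff_snd Y) (is_diff_fst Y.2)). Qed.

Lemma is_diff_proj22 (A B C : normedModType R) (Y : A * (B * C)) :
  is_diff Y (fun Y : A * (B * C) => Y.2.2) (fun Y : A * (B * C) => Y.2.2).
Proof. exact: (is_diff_comp (is_diff_snd Y) (is_diff_snd Y.2)). Qed.

Lemma near_proj11 (A B C : normedModType R) (Y : (A * B) * C) (P : set A) :
  (\forall x \near Y.1.1, P x) -> \forall Y' \near Y, P Y'.1.1.
Proof.
move=> nP; have [/differentiable_continuous cp _] := is_diff_proj11 Y.
exact: (cp _ nP).
Qed.

(** The covector component [W.1.2] is left out, because the Liouville form only sees the projection
    of a tangent vector to the base. *)
Lemma tmap_TsQ_cinv c p mu xi (h : G) (w : TsM) : atlas AG c -> dom c h ->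
  let ct := prod_chart (cot_chart c) (prod_chart (vec_chart gs) (vec_chart E)) in
  let W := tmap (vec_charted TsM) (TsQ_charted G) (cinv ct) ((c h, p), (mu, xi)) w in
  W.1.1 = chart_diff c (chart_at AG h) id h w.1.1 /\ W.2 = w.2.
Proof.
move=> Ac ch ct W; pose b := chart_at AG h.
have Ab : atlas AG b by exact: atlas_at.
have bh : dom b h by exact: dom_at.
have [nb dt] := trans_differentiable Ac Ab ch bh.
pose tau : E -> E := b \o id \o cinv c.
(* Covectors transform by the dual of the backward transition from [b] to [c], taken at the image
   point. *)
pose J (z : E) := lin1_mx ('d (c \o cinv b) z).
pose K (Y : TsM) : TsM := ((tau Y.1.1, J (tau Y.1.1) *m Y.1.2), Y.2).
pose Y0 : TsM := ((c h, p), (mu, xi)).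
have tauh : tau (c h) = b h by rewrite /tau /= lie_chartK.
have dtau : is_diff Y0 (fun Y : TsM => tau Y.1.1) (fun w => chart_diff c b id h w.1.1).
  exact: (is_diff_comp (is_diff_proj11 Y0)
    (differentiableP (dt : differentiable tau Y0.1.1))).
have dJ : is_diff Y0 (fun Y : TsM => J (tau Y.1.1))
    (fun w => 'd J (b h) (chart_diff c b id h w.1.1)).
  have dJ0 : is_diff (tau Y0.1.1) J ('d J (b h)).
    rewrite /= tauh; apply: differentiableP; exact: cot_trans_differentiable.
  exact: (is_diff_comp dtau dJ0).
have dK := is_diff_pair
  (is_diff_pair dtau (is_diff_mulmx dJ (is_diff_proj12 Y0))) (is_diff_snd Y0).
have nc := near_img Ac ch.
have n11 (P : set E) : (\forall x \near c h, P x) -> \forall Y \near Y0, P Y.1.1.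
  exact: (near_proj11 (Y := Y0)).
pose T := chart_at (TsQ_charted G) (cinv ct Y0) \o cinv ct.
have nK : \forall Y \near Y0, K Y = T Y.
  apply: filterS2 (n11 _ nc) (n11 _ nb) => -[[x q] [m k]] /= [h' ch' <-].
  rewrite /T /K /tau /= !(lie_chartK Ac) // => bh'.
  pose b' := chart_at AG h'.
  (* The covector at [h'] is stored through the preferred chart [b'] at [h'], which varies with
     [h']; the transitions into and out of [b'] compose to one from [b] to [c]. *)
  have e : J (b h') *m q = lin1_mx (tmap (vec_charted E) AG (cinv b) (b h')) *m
      (lin1_mx (tmap AG (vec_charted E) c h') *m q).
    apply: etrans (congr1 (mulmx^~ q) (esym
      (lin1_chart_diff_trans Ab (atlas_at h') Ac bh' (dom_at h') ch'))) _.
    apply: etrans (esym (mulmxA _ _ _)) _.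
    exact: (congr1 (fun f => lin1_mx f *m
      (lin1_mx (tmap AG (vec_charted E) c h') *m q)) (esym (tmap_cinv Ab bh'))).
  exact: (congr1 (fun u => ((b h', u), (m, k))) e).
have [_ dT] := near_eq_is_diff nK dK.
have -> : W = 'd T Y0 w by [].
by rewrite dT.
Qed.

Lemma tmap_TsQ_proj (y : TsQ G) (w : TsM) :
  tmap (TsQ_charted G) (Q_charted G) (@TsQ_proj R n G) y w = (w.1.1, w.2.1).
Proof.
case: y => [[h a] [mu xi]]; pose b := chart_at AG h.
have Ab : atlas AG b by exact: atlas_at.
have bh : dom b h by exact: dom_at.
pose y : TsQ G := ((h, a), (mu, xi)).
pose Y0 : TsM := chart_at (TsQ_charted G) y y.
pose T : TsM -> E * gs := chart_at (Q_charted G) (TsQ_proj y) \o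
  @TsQ_proj R n G \o cinv (chart_at (TsQ_charted G) y).
have dK : is_diff Y0 (fun Y : TsM => (Y.1.1, Y.2.1)) (fun Y : TsM => (Y.1.1, Y.2.1)).
  exact: (is_diff_pair (is_diff_proj11 Y0) (is_diff_proj21 Y0)).
have nK : \forall Y \near Y0, (Y.1.1, Y.2.1) = T Y.
  have nb : \forall x \near Y0.1.1, (b @` dom b) x by exact: near_img.
  apply: filterS (near_proj11 nb) => -[[x p] [m k]] /= [h' bh' <-].
  by rewrite /T /= /TsQ_proj /= (lie_chartK Ab).
have [_ dT] := near_eq_is_diff nK dK.
by have := congr1 (fun k => k w) dT.
Qed.

(** The vector and the covector are both carried from [c] to the preferred chart at [h], by mutually
    dual maps, so the pairing keeps its expression in [c]. *)
Lemma liouville_chart c (p mu : gs) xi (h : G) (w : TsM) : atlas AG c -> dom c h ->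
  let ct := prod_chart (cot_chart c) (prod_chart (vec_chart gs) (vec_chart E)) in
  liouville (cinv ct ((c h, p), (mu, xi)))
    (tmap (vec_charted TsM) (TsQ_charted G) (cinv ct) ((c h, p), (mu, xi)) w) =
  pairing p w.1.1 + pairing w.2.1 xi.
Proof.
move=> Ac ch ct.
rewrite /liouville tmap_TsQ_proj.
have [-> ->] := tmap_TsQ_cinv p mu xi w Ac ch.
congr (_ + _) => /=; rewrite lie_chartK // tmap_chart pairing_dual_map.
  by rewrite chart_diff_trans ?chart_diff_refl //; [exact: atlas_at|exact: dom_at].
exact: chart_diff_linear.
Qed.

(** Near the point the coefficients of the form are linear in the chart coordinates, so each
    derivative is the coefficient itself evaluated on the direction. *)
Lemma ext_d_liouville (y : TsQ G) (u v : TsM) :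
  ext_d (TsQ_charted G) (@liouville R n G) y u v =
  pairing u.1.2 v.1.1 + pairing v.2.1 u.2.2 -
  (pairing v.1.2 u.1.1 + pairing u.2.1 v.2.2).
Proof.
case: y => [[h a] [mu xi]]; pose c := chart_at AG h.
have Ac : atlas AG c by exact: atlas_at.
have ch : dom c h by exact: dom_at.
pose y : TsQ G := ((h, a), (mu, xi)).
pose Y0 : TsM := chart_at (TsQ_charted G) y y.
pose ct := chart_at (TsQ_charted G) y.
pose th (w Y : TsM) : R := liouville (cinv ct Y)
  (tmap (vec_charted TsM) (TsQ_charted G) (cinv ct) Y w).
pose k (w Y : TsM) : R^o := pairing Y.1.2 w.1.1 + pairing w.2.1 Y.2.2.
have dk w : is_diff Y0 (k w) (fun Y => k w Y).
  have d1 := is_diff_pairing (is_diff_proj12 Y0) (is_diff_cst w.1.1 Y0).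
  have d2 := is_diff_pairing (is_diff_cst w.2.1 Y0) (is_diff_proj22 Y0).
  apply: is_diff_eq (is_diffD d1 d2) _; apply/funext => Y /=.
  rewrite /k; congr (_ + _); rewrite /pairing ?mul0mx ?mulmx0 !mxE ?addr0 ?add0r //.
have nk w : \forall Y \near Y0, k w Y = th w Y.
  have nc : \forall x \near Y0.1.1, (c @` dom c) x by exact: near_img.
  apply: filterS (near_proj11 nc) => -[[x p] [m q]] /= [h' ch' <-].
  exact: esym (liouville_chart p m q w Ac ch').
have D w z : 'D_z (th w) Y0 = k w z.
  by have [_ ->] := diff_is_derive z (near_eq_is_diff (nk w) (dk w)).
exact: (congr2 (fun p q : R => p - q) (D v u) (D u v)).
Qed.

End Liouville.

(** * Algebra of the pairing and of an abstract coadjoint action *)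

Section Pairing.
Variables (R : realType) (n : nat).
Notation E := 'rV[R]_n.
Notation gs := 'cV[R]_n.

Lemma pairingDl (a b : gs) (xi : E) : pairing (a + b) xi = pairing a xi + pairing b xi.
Proof. by rewrite /pairing mulmxDr mxE. Qed.

Lemma pairingNl (a : gs) (xi : E) : pairing (- a) xi = - pairing a xi.
Proof. by rewrite /pairing mulmxN mxE. Qed.

Lemma pairingZl r (a : gs) (xi : E) : pairing (r *: a) xi = r * pairing a xi.
Proof. by rewrite /pairing -scalemxAr mxE. Qed.

Lemma pairingDr (a : gs) (x y : E) : pairing a (x + y) = pairing a x + pairing a y.
Proof. by rewrite /pairing mulmxDl mxE. Qed.

Lemma pairingNr (a : gs) (xi : E) : pairing a (- xi) = - pairing a xi.
Proof. by rewrite /pairing mulNmx mxE. Qed.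

Lemma pairingZr r (a : gs) (xi : E) : pairing a (r *: xi) = r * pairing a xi.
Proof. by rewrite /pairing -scalemxAl mxE. Qed.

Lemma pairing_delta (a : gs) i : pairing a (delta_mx 0 i) = a i 0.
Proof. by rewrite /pairing -rowE mxE. Qed.

Lemma pairing_delta_col (xi : E) i : pairing (delta_mx i 0) xi = xi 0 i.
Proof. by rewrite /pairing -colE mxE. Qed.

Lemma pairing_extl (a b : gs) : (forall xi, pairing a xi = pairing b xi) -> a = b.
Proof. by move=> ab; apply/colP => i; rewrite -!pairing_delta. Qed.

Lemma pairing_extr (x y : E) : (forall a : gs, pairing a x = pairing a y) -> x = y.
Proof. by move=> ab; apply/rowP => i; rewrite -!pairing_delta_col. Qed.

Section coadjoint.
Variables (br : E -> E -> E) (A : E -> gs -> gs).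
Hypothesis pairing_A : forall xi mu eta,
  pairing (A xi mu) eta = - pairing mu (br xi eta).
Hypothesis brl : forall eta, linear (br^~ eta).

(* The canonical form on the vectors (T_e R_g eta, um, un, ux) and
   (T_e R_g zeta, vm, vn, vx) at (g, mu, nu, xi), where A stands for ad^*. *)
Definition triv_form (mu nu : gs) (xi eta zeta : E) (um un vm vn : gs) (ux vx : E) : R :=
  pairing (un + (A xi um + A ux mu)) zeta
  - pairing (vn + (A xi vm + A vx mu)) eta
  + pairing vm ux - pairing um vx + pairing (nu + A xi mu) (br eta zeta).

Lemma coadjoint_linearl mu : linear (A^~ mu).
Proof.
move=> a u v; apply: pairing_extl => x.
by rewrite pairingDl pairingZl !pairing_A brl pairingDr pairingZr opprD mulrN.
Qed.

Lemma coadjoint_linearr xi : linear (A xi).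
Proof.
move=> a u v; apply: pairing_extl => x.
by rewrite pairingDl pairingZl !pairing_A pairingDl pairingZl opprD mulrN.
Qed.

End coadjoint.
End Pairing.

Lemma regroup_liouville (R : comRingType) (a a' b b' p q : R) :
  a - p + b - (a' - q + b') = a - a' + b - b' + (q - p).
Proof. by ring. Qed.

(** * The transported form on right trivialized vectors *)

Section Omega.
Variables (R : realType) (n : nat) (G : lieGroup R n).
Notation E := 'rV[R]_n.
Notation gs := 'cV[R]_n.
Notation AG := (lie_charted G).
Variables (exp : E -> G) (exp_spec : is_lie_exp exp).
Notation br := (bracket G).
Notation ads := (ads exp).

Lemma pairing_ads xi mu eta : pairing (ads xi mu) eta = - pairing mu (br xi eta).
Proof.
rewrite /Defs.ads pairingNl; congr (- _).
have -> : ad exp xi = br xi by apply/funext => v; exact: ad_bracket.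
by apply: pairing_dual_map; exact: bracket_linearr.
Qed.

Lemma ads_linearl mu : linear (ads^~ mu).
Proof. exact: coadjoint_linearl pairing_ads (@bracket_linearl _ _ G) mu. Qed.

Lemma ads_linearr xi : linear (ads xi).
Proof. exact: coadjoint_linearr pairing_ads xi. Qed.

Lemma is_diff_ads (V : normedModType R) (f df : V -> E) (h dh : V -> gs) x :
  is_diff x f df -> is_diff x h dh ->
  is_diff x (fun y => ads (f y) (h y)) (fun v => ads (f x) (dh v) + ads (df v) (h x)).
Proof.
apply: is_diff_bilin; do ?exact: finite_basis_mx.
- exact: ads_linearl.
- exact: ads_linearr.
Qed.

Lemma pairing_mulmx (A : 'M[R]_n) (a : gs) (xi : E) :
  pairing (A *m a) xi = pairing a (xi *m A).
Proof. by rewrite /pairing mulmxA. Qed.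

Lemma invmx_factor (M T C B : 'M[R]_n) : T \in unitmx -> M \in unitmx ->
  M = T *m C -> C *m B = 1%:M -> B *m invmx T = invmx M.
Proof.
move=> uT uM ME CB; rewrite -[LHS](mulKmx uM) {2}ME -mulmxA (mulmxA C) CB mul1mx.
by rewrite mulmxV // mulmx1.
Qed.

(** Passing from the preferred chart at [h] to [c] turns the inverse of [TeR h] into the inverse of
    [rmx], which can be differentiated in the point. *)
Lemma dual_tmap_cinv c (h : G) (l : gs) : atlas AG c -> dom c h ->
  dual_map (tmap (vec_charted E) AG (cinv c) (c h)) (invmx (lin1_mx (TeR h)) *m l) =
  invmx (rmx c (c h)) *m l.
Proof.
move=> Ac ch; rewrite /dual_map mulmxA; congr (_ *m _).
rewrite tmap_cinv //; apply: (invmx_factor (TeR_unitmx h)).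
- exact: rmx_unit.
- exact: rmx_TeR.
apply: etrans (lin1_chart_diff_trans (atlas_at h) Ac (atlas_at h) (dom_at h) ch
  (dom_at h)) _.
by apply: lin1_chart_diff_refl; [exact: atlas_at|exact: dom_at].
Qed.

(** The covector component is given implicitly, by the product rule on rho_x^* p = nu + ad^*_xi mu,
    so that no derivative of an inverse matrix appears. Differentiability of p still comes from
    [differentiable_invmx]. *)
Lemma tmap_triv_inv g mu nu xi (ug : E) (um un : gs) (ux : E) :
  let z : TTG G := (g, mu, nu, xi) in
  let c := chart_at AG g in
  let T := tmap (TTG_charted G) (TsQ_charted G) (triv_inv exp) z (ug, um, un, ux) in
  [/\ T.1.1 = ug, T.2 = (um, ux) &
      rmx c (c g) *m T.1.2 + 'd (rmx c) (c g) ug *m (triv_inv exp z).1.2 =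
      un + (ads xi um + ads ux mu)].
Proof.
move=> z c T.
have Ac : atlas AG c by exact: atlas_at.
have cg : dom c g by exact: dom_at.
pose Z0 : TTG_model R n := chart_at (TTG_charted G) z z.
pose P (Z : TTG_model R n) : gs := invmx (rmx c Z.1.1.1) *m (Z.1.2 + ads Z.2 Z.1.1.2).
pose S (Z : TTG_model R n) : ((E * gs) * (gs * E))%type :=
  ((Z.1.1.1, P Z), (Z.1.1.2, Z.2)).
pose Q : TTG_model R n -> ((E * gs) * (gs * E))%type :=
  chart_at (TsQ_charted G) (triv_inv exp z) \o triv_inv exp \o
  cinv (chart_at (TTG_charted G) z).
have d1 : is_diff Z0 (fun Z : TTG_model R n => Z.1) (fun Z => Z.1) by exact: is_diff_fst.
have d2 : is_diff Z0 (fun Z : TTG_model R n => Z.2) (fun Z => Z.2) by exact: is_diff_snd.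
have d12 : is_diff Z0 (fun Z : TTG_model R n => Z.1.2) (fun Z => Z.1.2).
  exact: is_diff_proj12.
have d111 : is_diff Z0 (fun Z : TTG_model R n => Z.1.1.1) (fun Z => Z.1.1.1).
  exact: (is_diff_comp d1 (is_diff_proj11 Z0.1)).
have d112 : is_diff Z0 (fun Z : TTG_model R n => Z.1.1.2) (fun Z => Z.1.1.2).
  exact: (is_diff_comp d1 (is_diff_proj12 Z0.1)).
have n111 (A : set E) : (\forall x \near c g, A x) -> \forall Z \near Z0, A Z.1.1.1.
  by move=> nP; have [/differentiable_continuous cp _] := d111; exact: (cp _ nP).
have dl := is_diffD d12 (is_diff_ads d2 d112).
have dR : is_diff Z0 (fun Z : TTG_model R n => rmx c Z.1.1.1)
    (fun Z => 'd (rmx c) (c g) Z.1.1.1).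
  have dR0 : differentiable (rmx c) Z0.1.1.1 by exact: rmx_differentiable.
  exact: (is_diff_comp d111 (differentiableP dR0)).
have nunit := n111 _ (near_rmx_unit Ac cg).
have dP : differentiable P Z0.
  have [dR0 _] := dR.
  have [dP _] := is_diff_mulmx (differentiableP (differentiable_invmx nunit dR0)) dl.
  exact: dP.
have dS : is_diff Z0 S (fun Z => ((Z.1.1.1, 'd P Z0 Z), (Z.1.1.2, Z.2))).
  exact: (is_diff_pair (is_diff_pair d111 (differentiableP dP)) (is_diff_pair d112 d2)).
have nS : \forall Z \near Z0, S Z = Q Z.
  apply: filterS (n111 _ (near_img Ac cg)) => -[[[x m] k] q] /= [h ch <-].
  rewrite /S /Q /P /= (lie_chartK Ac) //.
  exact: (congr1 (fun p => ((c h, p), (m, q))) (esym (dual_tmap_cinv _ Ac ch))).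
have [_ dQ] := near_eq_is_diff nS dS.
have TE : T = ((ug, 'd P Z0 (ug, um, un, ux)), (um, ux)).
  by have := congr1 (fun k => k (ug, um, un, ux)) dQ.
rewrite TE /=; split => //.
have nP : \forall Z \near Z0, rmx c Z.1.1.1 *m P Z = Z.1.2 + ads Z.2 Z.1.1.2.
  by apply: filterS nunit => Z uZ; rewrite /P mulKVmx.
have PE : P Z0 = invmx (lin1_mx (TeR g)) *m (nu + ads xi mu).
  rewrite /P /=; apply: etrans (esym (dual_tmap_cinv _ Ac cg)) _.
  apply: etrans (congr1 (fun f => lin1_mx f *m
    (invmx (lin1_mx (TeR g)) *m (nu + ads xi mu))) (tmap_cinv Ac cg)) _.
  exact: etrans (congr1 (mulmx^~ _) (lin1_chart_diff_refl Ac cg)) (mul1mx _).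
have := is_diff_uniq (near_eq_is_diff nP (is_diff_mulmx dR (differentiableP dP))) dl
  (ug, um, un, ux).
by rewrite /= PE.
Qed.

Lemma rmx_at g : rmx (chart_at AG g) (chart_at AG g g) = lin1_mx (TeR g).
Proof.
apply: etrans (rmx_TeR (atlas_at g) (dom_at g)) _.
exact: etrans (congr1 (mulmx _) (lin1_chart_diff_refl (atlas_at g) (dom_at g)))
  (mulmx1 _).
Qed.

Lemma rfield_at g eta : rfield (chart_at AG g) (chart_at AG g g) eta = TeR g eta.
Proof.
apply: etrans (rfield_TeR _ (atlas_at g) (dom_at g)) _.
exact: chart_diff_refl (atlas_at g) (dom_at g).
Qed.

(** Against [TeR g zeta] the implicit equation becomes explicit, and the derivative of rho becomes
    that of one invariant field, the form met in [maurer_cartan]. *)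
Lemma pairing_tmap_triv_inv g mu nu xi ug um un ux zeta :
  let z : TTG G := (g, mu, nu, xi) in
  let c := chart_at AG g in
  let T := tmap (TTG_charted G) (TsQ_charted G) (triv_inv exp) z (ug, um, un, ux) in
  pairing T.1.2 (TeR g zeta) =
  pairing (un + (ads xi um + ads ux mu)) zeta -
  pairing (triv_inv exp z).1.2 ('D_ug (fun x => rfield c x zeta) (c g)).
Proof.
move=> z c T.
have Ac : atlas AG c by exact: atlas_at.
have cg : dom c g by exact: dom_at.
have [_ _ <-] := tmap_triv_inv g mu nu xi ug um un ux.
rewrite pairingDl !pairing_mulmx rmx_at (mul_lin1_linear _ (TeR_linear g)).
have dR := differentiableP (rmx_differentiable Ac cg).
have -> : zeta *m 'd (rmx c) (c g) ug = 'D_ug (fun x => rfield c x zeta) (c g).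
  have := is_diff_uniq (near_eq_is_diff (near_rmxE zeta Ac cg)
    (is_diff_mulmx (is_diff_cst zeta (c g)) dR))
    (differentiableP (rfield_differentiable zeta Ac cg)) ug.
  rewrite -(deriveE _ (rfield_differentiable zeta Ac cg)) => <-.
  by rewrite mul0mx addr0.
by rewrite addrK.
Qed.

Lemma pairing_triv_inv g mu nu xi zeta :
  pairing (triv_inv exp (g, mu, nu, xi)).1.2 (TeR g zeta) = pairing (nu + ads xi mu) zeta.
Proof.
rewrite /= pairing_mulmx -(mul_lin1_linear _ (TeR_linear g)) mulmxK //.
exact: TeR_unitmx.
Qed.

(** The two terms with a derivative of rho pair the covector at the point with a difference of
    derivatives, which Maurer-Cartan turns into [TeR g] of the bracket. *)
Lemma OmegaE g mu nu xi (eta zeta : E) (um un vm vn : gs) (ux vx : E) :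
  Omega exp (g, mu, nu, xi) (TeR g eta, um, un, ux) (TeR g zeta, vm, vn, vx) =
  triv_form br ads mu nu xi eta zeta um un vm vn ux vx.
Proof.
pose z : TTG G := (g, mu, nu, xi); pose c := chart_at AG g.
have Ac : atlas AG c by exact: atlas_at.
have cg : dom c g by exact: dom_at.
rewrite /Omega ext_d_liouville.
have [u1 u2 _] := tmap_triv_inv g mu nu xi (TeR g eta) um un ux.
have [v1 v2 _] := tmap_triv_inv g mu nu xi (TeR g zeta) vm vn vx.
have mc : TeR g (br eta zeta) =
    'D_(TeR g zeta) (fun x => rfield c x eta) (c g)
    - 'D_(TeR g eta) (fun x => rfield c x zeta) (c g).
  have := maurer_cartan Ac cg eta zeta; rewrite !rfield_at => mc.
  exact: etrans (esym (opprK _)) (etrans (congr1 -%R (esym mc)) (opprB _ _)).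
rewrite /triv_form u1 u2 v1 v2 /= !pairing_tmap_triv_inv.
rewrite -(pairing_triv_inv g mu nu xi (br eta zeta)) mc pairingDr pairingNr.
exact: regroup_liouville.
Qed.

End Omega.

(** * Hamilton's equations *)

Section HamiltonAlgebra.
Variables (R : realType) (n : nat).
Notation E := 'rV[R]_n.
Notation gs := 'cV[R]_n.
Variables (br : E -> E -> E) (A : E -> gs -> gs).
Hypothesis pairing_A : forall xi mu eta,
  pairing (A xi mu) eta = - pairing mu (br xi eta).
Hypothesis brl : forall eta, linear (br^~ eta).
Hypothesis brC : forall xi eta, br xi eta = - br eta xi.
Hypothesis br_jacobi : forall xi eta zeta,
  br xi (br eta zeta) = br eta (br xi zeta) + br (br xi eta) zeta.

Notation omega := (triv_form br A).

(** Terms in [nu] and [dxi] cancel in pairs, and those in [wm] and [wx] by antisymmetry. Here [t]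
    stands for the right trivialized [delta_g]. *)
Lemma hamilton_omega mu nu xi zeta wm wn wx dmu dnu dxi t :
  omega mu nu xi dnu zeta (dxi + A dnu mu)
    (A dmu mu - t + A dnu nu - A xi dxi) wm wn (- dmu + br dnu xi) wx =
  - (pairing t zeta + pairing wm dmu + pairing wn dnu + pairing dxi wx).
Proof.
have brDl u v w : br (u + v) w = br u w + br v w.
  by have := brl w 1 u v; rewrite !scale1r.
have brNl u w : br (- u) w = - br u w.
  have br0 : br 0 w = 0 by have := brl w (-1) 0 0; rewrite !scaleN1r !addNr.
  by have := brl w (-1) u 0; rewrite !scaleN1r br0 !addr0.
rewrite /triv_form !(pairingDl, pairingNl, pairing_A, pairingDr, pairingNr, brDl, brNl).
(* The double brackets, all paired with [mu], are [dnu, [xi, zeta]], [xi, [dnu, zeta]] and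
   [[dnu, xi], zeta]. *)
rewrite (br_jacobi dnu xi) (brC wx dnu) (brC xi dnu) !(pairingDr, pairingNr).
by ring.
Qed.

(** The form is triangular: testing with [wn] alone isolates [eta], then [wx] gives [um], [wm] gives
    [ux], and [zeta], which meets all components, gives [un] last. *)
Lemma omega_inj mu nu xi eta eta' um un um' un' ux ux' :
  (forall zeta wm wn wx, omega mu nu xi eta zeta um un wm wn ux wx =
     omega mu nu xi eta' zeta um' un' wm wn ux' wx) ->
  [/\ eta = eta', um = um', un = un' & ux = ux'].
Proof.
move=> H.
have p0l (x : E) : pairing 0 x = 0 by rewrite /pairing mulmx0 mxE.
have p0r (a : gs) : pairing a 0 = 0 by rewrite /pairing mul0mx mxE.
have A0r x : A x 0 = 0.
  by apply: pairing_extl => y; rewrite pairing_A !p0l oppr0.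
have br0l y : br 0 y = 0.
  by have := brl y (-1) 0 0; rewrite !scaleN1r !addNr.
have br0r y : br y 0 = 0 by rewrite brC br0l oppr0.
have A0l a : A 0 a = 0.
  by apply: pairing_extl => y; rewrite pairing_A br0l p0r p0l oppr0.
have S := (p0l, p0r, A0r, A0l, br0r, sub0r, subr0, add0r, addr0).
have etaE : eta = eta'.
  apply: pairing_extr => a; have := H 0 0 a 0.
  by rewrite /triv_form !S => /oppr_inj.
rewrite -etaE in H *.
have umE : um = um'.
  apply: pairing_extl => x; have := H 0 0 0 x.
  by rewrite /triv_form !S => /addrI/oppr_inj.
rewrite -umE in H *.
have uxE : ux = ux'.
  apply: pairing_extr => a; have := H 0 a 0 0.
  by rewrite /triv_form !S => /addrI.
rewrite -uxE in H *.
split => //; apply: pairing_extl => x; have := H x 0 0 0.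
by rewrite /triv_form !S => /addIr; rewrite !pairingDl => /addIr.
Qed.

End HamiltonAlgebra.

(** * Velocities of curves in products *)

Section Velocity.
Variable R : realType.

Lemma is_derive_pairP (V W : normedModType R) (f : R -> V) (h : R -> W) t u v :
  is_derive t (1 : R) (fun s => (f s, h s)) (u, v) <->
  is_derive t (1 : R) f u /\ is_derive t (1 : R) h v.
Proof.
split=> [|[df dh]].
  move=> /derive_is_diff d; split.
    have /= := diff_derive1 (is_diff_comp d (is_diff_fst (f t, h t))) erefl.
    by rewrite scale1r.
  have /= := diff_derive1 (is_diff_comp d (is_diff_snd (f t, h t))) erefl.
  by rewrite scale1r.
have /= := diff_derive1 (is_diff_pair (derive_is_diff df) (derive_is_diff dh)) erefl.
by rewrite !scale1r.
Qed.

Lemma has_velocity_prod (M N : Type) (E F : normedModType R)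
    (A : charted M E) (B : charted N F) (f : R -> M) (h : R -> N) t u v :
  has_velocity (prod_charted A B) (fun s => (f s, h s)) t (u, v) <->
  has_velocity A f t u /\ has_velocity B h t v.
Proof.
split.
  move=> [nd /is_derive_pairP[df dh]]; split; split => //.
    by apply: filterS nd => s [].
  by apply: filterS nd => s [].
move=> [[nf df] [nh dh]]; split; last exact/is_derive_pairP.
by apply: filterS2 nf nh => s.
Qed.

Lemma has_velocity_vec (V : normedModType R) (f : R -> V) t v :
  has_velocity (vec_charted V) f t v <-> is_derive t (1 : R) f v.
Proof. by split=> [[]|df] //; split => //; apply: filterE. Qed.

End Velocity.

Lemma linear_col_sum (R : realType) n (V : lmodType R) (f : 'cV[R]_n -> V) v :
  linear f -> f v = \sum_i v i 0 *: f (delta_mx i 0).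
Proof.
move=> lf; pose F : {linear 'cV[R]_n -> V} :=
  HB.pack f (GRing.isLinear.Build _ _ _ _ _ lf).
rewrite [in LHS](matrix_sum_delta v) -[LHS]/(F _) linear_sum.
by apply: eq_bigr => i _; rewrite big_ord1 linearZ.
Qed.

(** * The differential of H and its partial derivatives *)

Section Differential.
Variables (R : realType) (n : nat) (G : lieGroup R n).
Notation E := 'rV[R]_n.
Notation gs := 'cV[R]_n.
Notation AG := (lie_charted G).
Variables (H : TTG G -> R) (H_smooth : smooth_map (TTG_charted G) (real_charted R) H).
Notation TM := (TTG_model R n).

Definition TTG_chart (c : chart G E) : chart (TTG G) TM :=
  prod_chart (prod_chart (prod_chart c (vec_chart gs)) (vec_chart gs)) (vec_chart E).

Lemma TTG_atlas c : atlas AG c -> atlas (TTG_charted G) (TTG_chart c).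
Proof.
move=> Ac; exists (prod_chart (prod_chart c (vec_chart gs)) (vec_chart gs));
  last by exists (vec_chart E).
exists (prod_chart c (vec_chart gs)); last by exists (vec_chart gs).
by exists c => //; exists (vec_chart gs).
Qed.

Definition H_rep (c : chart G E) (Z : TM) : R^o :=
  H (cinv c Z.1.1.1, Z.1.1.2, Z.1.2, Z.2).

Lemma H_rep_smooth c : atlas AG c ->
  smooth_on [set Z : TM | (c @` dom c) Z.1.1.1] (H_rep c).
Proof.
move=> Ac k; apply: Ck_cover => -[[[x m] l] q] /= [g cg <-].
have AC := TTG_atlas Ac.
have dC : dom (TTG_chart c) (g, m, l, q) by [].
have dr : atlas (real_charted R) (vec_chart R^o) by [].
have [U [oU Up _ _ sU]] := H_smooth AC dC dr I.
by exists U; [exact: Up|exact: sU].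
Qed.

Lemma H_rep_differentiable c g m l q : atlas AG c -> dom c g ->
  differentiable (H_rep c) (c g, m, l, q).
Proof. by move=> Ac cg; have [+ _] := H_rep_smooth Ac 1%N; apply; exists g. Qed.

(** Partial derivatives relative to one fixed chart, hence smooth on it; the components of [delta_g]
    refer to a preferred chart that changes with the point. *)
Definition rep_g c (Z : TM) : gs := \col_i 'D_(delta_mx 0 i, 0, 0, 0) (H_rep c) Z.
Definition rep_mu c (Z : TM) : E := \row_i 'D_(0, delta_mx i 0, 0, 0) (H_rep c) Z.
Definition rep_nu c (Z : TM) : E := \row_i 'D_(0, 0, delta_mx i 0, 0) (H_rep c) Z.
Definition rep_xi c (Z : TM) : gs := \col_i 'D_(0, 0, 0, delta_mx 0 i) (H_rep c) Z.

Section at_point.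
Variables (c : chart G E) (g : G) (mu nu : gs) (xi : E).
Hypotheses (Ac : atlas AG c) (cg : dom c g).
Notation Z0 := ((c g, mu, nu, xi) : TM).
Notation z := ((g, mu, nu, xi) : TTG G).

Lemma partial_chart (V : normedModType R) (i di : V -> TM) (v : V) :
  i v = Z0 -> is_diff v i di ->
  is_diff v (fun y => H_rep c (i y)) (fun w => 'D_(di w) (H_rep c) Z0).
Proof.
move=> iv di_; have dH := H_rep_differentiable mu nu xi Ac cg.
have dH' : is_diff (i v) (H_rep c) ('d (H_rep c) Z0).
  by rewrite iv; exact: differentiableP.
apply: is_diff_eq (is_diff_comp di_ dH') _.
by apply/funext => w; rewrite deriveE.
Qed.

Lemma delta_mu_rep : delta_mu H z = rep_mu c Z0.
Proof.
apply/rowP => i; rewrite !mxE.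
have d : is_diff mu (fun m : gs => (c g, m, nu, xi) : TM) (fun m => (0, m, 0, 0)).
  exact: (is_diff_pair (is_diff_pair (is_diff_pair (is_diff_cst (c g) mu)
    (is_diff_id mu)) (is_diff_cst nu mu)) (is_diff_cst xi mu)).
have [_ dE] := partial_chart erefl d.
have fE : (fun m : gs => H (g, m, nu, xi) : R^o) = fun m => H_rep c (c g, m, nu, xi).
  by apply/funext => m; rewrite /H_rep /= lie_chartK.
by rewrite fE dE.
Qed.

Lemma delta_nu_rep : delta_nu H z = rep_nu c Z0.
Proof.
apply/rowP => i; rewrite !mxE.
have d : is_diff nu (fun m : gs => (c g, mu, m, xi) : TM) (fun m => (0, 0, m, 0)).
  exact: (is_diff_pair (is_diff_pair (is_diff_cst (c g, mu) nu) (is_diff_id nu))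
    (is_diff_cst xi nu)).
have [_ dE] := partial_chart erefl d.
have fE : (fun m : gs => H (g, mu, m, xi) : R^o) = fun m => H_rep c (c g, mu, m, xi).
  by apply/funext => m; rewrite /H_rep /= lie_chartK.
by rewrite fE dE.
Qed.

Lemma delta_xi_rep : delta_xi H z = rep_xi c Z0.
Proof.
apply/colP => i; rewrite !mxE.
have d : is_diff xi (fun m : E => (c g, mu, nu, m) : TM) (fun m => (0, 0, 0, m)).
  exact: (is_diff_pair (is_diff_cst (c g, mu, nu) xi) (is_diff_id xi)).
have [_ dE] := partial_chart erefl d.
have fE : (fun m : E => H (g, mu, nu, m) : R^o) = fun m => H_rep c (c g, mu, nu, m).
  by apply/funext => m; rewrite /H_rep /= lie_chartK.
by rewrite fE dE.
Qed.

Lemma D_linear (X : normedModType R) (f : TM -> X) Z : differentiable f Z ->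
  forall (a : R) u v, 'D_(a *: u + v) f Z = a *: 'D_u f Z + 'D_v f Z.
Proof. by move=> df a u v; rewrite !deriveE // linearP. Qed.

Lemma pairing_rep_g v : pairing (rep_g c Z0) v = 'D_(v, 0, 0, 0) (H_rep c) Z0.
Proof.
have dH := H_rep_differentiable mu nu xi Ac cg.
have lv : linear (fun v : E => 'D_(v, 0, 0, 0) (H_rep c) Z0).
  move=> a u w.
  have z0 (V : lmodType R) : 0 = a *: (0 : V) + 0 by rewrite scaler0 addr0.
  have e : ((a *: u + w, 0, 0, 0) : TM) = a *: ((u, 0, 0, 0) : TM) + (w, 0, 0, 0).
    transitivity ((a *: u + w, a *: 0 + 0, a *: 0 + 0, a *: 0 + 0) : TM) => //.
    by rewrite -!z0.
  exact: etrans (congr1 (fun Z => 'D_Z (H_rep c) Z0) e)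
    (D_linear dH a (u, 0, 0, 0) (w, 0, 0, 0)).
rewrite [RHS](linear_row_sum v lv) /pairing mxE.
by apply: eq_bigr => i _; rewrite mxE.
Qed.

Lemma delta_g_rep :
  delta_g H z = lin1_mx (chart_diff (chart_at AG g) c id g) *m rep_g c Z0.
Proof.
pose b := chart_at AG g.
have Ab : atlas AG b by exact: atlas_at.
have bg : dom b g by exact: dom_at.
apply/colP => i; rewrite -!pairing_delta pairing_mulmx.
rewrite (mul_lin1_linear _ (@chart_diff_linear _ _ _ _ _ _ _ _ _)) pairing_rep_g.
rewrite pairing_delta mxE.
have [nt dt] := trans_differentiable Ab Ac bg cg.
have d : is_diff (b g) (fun x : E => ((c \o id \o cinv b) x, mu, nu, xi) : TM)
    (fun v => (chart_diff b c id g v, 0, 0, 0)).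
  exact: (is_diff_pair (is_diff_pair (is_diff_pair (differentiableP dt)
    (is_diff_cst mu (b g))) (is_diff_cst nu (b g))) (is_diff_cst xi (b g))).
have iE : ((c \o id \o cinv b) (b g), mu, nu, xi) = Z0 by rewrite /= lie_chartK.
have fE : \forall x \near b g, H_rep c ((c \o id \o cinv b) x, mu, nu, xi) =
    (H (cinv b x, mu, nu, xi) : R^o).
  by apply: filterS nt => x dx; rewrite /H_rep /= lie_chartK.
have [_ dE] := near_eq_is_diff fE (partial_chart iE d).
by have := congr1 (fun k => k (delta_mx 0 i)) dE.
Qed.

Lemma pairing_delta_g v :
  pairing (delta_g H z) v =
  'D_(chart_diff (chart_at AG g) c id g v, 0, 0, 0) (H_rep c) Z0.
Proof.
rewrite delta_g_rep pairing_mulmx.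
rewrite (mul_lin1_linear _ (@chart_diff_linear _ _ _ _ _ _ _ _ _)).
exact: pairing_rep_g.
Qed.

(** The transition inside [delta_g] is absorbed by [TeR g] to give [rmx], leaving an expression
    smooth in the point. *)
Lemma dual_TeR_delta_g : dual_map (TeR g) (delta_g H z) = rmx c (c g) *m rep_g c Z0.
Proof.
rewrite /dual_map delta_g_rep mulmxA; congr (_ *m _).
exact: esym (rmx_TeR Ac cg).
Qed.

End at_point.

Lemma tmap_H g mu nu xi (ug : E) (um un : gs) (ux : E) :
  let z : TTG G := (g, mu, nu, xi) in
  tmap (TTG_charted G) (real_charted R) H z (ug, um, un, ux) =
  pairing (delta_g H z) ug + pairing um (delta_mu H z)
  + pairing un (delta_nu H z) + pairing (delta_xi H z) ux.
Proof.
move=> z; pose c := chart_at AG g.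
have Ac : atlas AG c by exact: atlas_at.
have cg : dom c g by exact: dom_at.
pose Z0 : TM := (c g, mu, nu, xi).
have dH := H_rep_differentiable mu nu xi Ac cg.
have lin_row (f : E -> TM) (v : E) : linear f ->
    'D_(f v) (H_rep c) Z0 = pairing (\col_i 'D_(f (delta_mx 0 i)) (H_rep c) Z0) v.
  move=> lf; have l : linear (fun v => 'D_(f v) (H_rep c) Z0).
    by move=> a u w; rewrite (lf a u w); exact: (D_linear dH a (f u) (f w)).
  rewrite [LHS](linear_row_sum v l) /pairing mxE.
  by apply: eq_bigr => i _; rewrite mxE.
have lin_col (f : gs -> TM) (v : gs) : linear f ->
    'D_(f v) (H_rep c) Z0 = pairing v (\row_i 'D_(f (delta_mx i 0)) (H_rep c) Z0).
  move=> lf; have l : linear (fun v => 'D_(f v) (H_rep c) Z0).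
    by move=> a u w; rewrite (lf a u w); exact: (D_linear dH a (f u) (f w)).
  rewrite [LHS](linear_col_sum v l) /pairing mxE.
  by apply: eq_bigr => i _; rewrite mxE mulrC.
have uE : ((ug, um, un, ux) : TM) =
  (ug, 0, 0, 0) + (0, um, 0, 0) + (0, 0, un, 0) + (0, 0, 0, ux).
  (* Addition in a product is componentwise by conversion, so only the padding zeros need
     rewriting. *)
  transitivity ((ug + 0 + 0 + 0, 0 + um + 0 + 0, 0 + 0 + un + 0,
    0 + 0 + 0 + ux) : TM) => //.
  by rewrite !addr0 !add0r.
have TE : tmap (TTG_charted G) (real_charted R) H z (ug, um, un, ux) =
  'D_((ug, um, un, ux) : TM) (H_rep c) Z0.
  exact: esym (deriveE _ dH).
rewrite TE uE.
have DD (a b : TM) : 'D_(a + b) (H_rep c) Z0 = 'D_a (H_rep c) Z0 + 'D_b (H_rep c) Z0.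
  by rewrite !deriveE // linearD.
rewrite !DD (delta_mu_rep _ _ _ Ac cg) (delta_nu_rep _ _ _ Ac cg).
rewrite (delta_xi_rep _ _ _ Ac cg).
rewrite (pairing_delta_g _ _ _ Ac cg) chart_diff_refl //; congr (_ + _ + _ + _).
- apply: (lin_col (fun m => (0, m, 0, 0))) => a u w.
  transitivity ((a *: 0 + 0, a *: u + w, a *: 0 + 0, a *: 0 + 0) : TM) => //.
  by rewrite !scaler0 !addr0.
- apply: (lin_col (fun m => (0, 0, m, 0))) => a u w.
  transitivity ((a *: 0 + 0, a *: 0 + 0, a *: u + w, a *: 0 + 0) : TM) => //.
  by rewrite !scaler0 !addr0.
- apply: (lin_row (fun m => (0, 0, 0, m))) => a u w.
  transitivity ((a *: 0 + 0, a *: 0 + 0, a *: 0 + 0, a *: u + w) : TM) => //.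
  by rewrite !scaler0 !addr0.
Qed.

End Differential.

(** * Existence, uniqueness and smoothness of the Hamiltonian field *)

Section HamiltonianField.
Variables (R : realType) (n : nat) (G : lieGroup R n).
Notation E := 'rV[R]_n.
Notation gs := 'cV[R]_n.
Notation AG := (lie_charted G).
Notation TM := (TTG_model R n).
Variables (exp : E -> G) (exp_spec : is_lie_exp exp).
Variables (H : TTG G -> R) (H_smooth : smooth_map (TTG_charted G) (real_charted R) H).
Notation ads := (ads exp).

(** The announced right invariant vector unfolded, with [bracket] in place of [ad] so that the
    bilinear algebra applies directly. *)
Definition ham_field (z : TTG G) : TM :=
  let: (g, mu, nu, xi) := z in
  (TeR g (delta_nu H z), delta_xi H z + ads (delta_nu H z) mu,
   ads (delta_mu H z) mu - dual_map (TeR g) (delta_g H z)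
   + ads (delta_nu H z) nu - ads xi (delta_xi H z),
   - delta_mu H z + bracket G (delta_nu H z) xi).

(** Puts every tangent vector in the right trivialized form that [OmegaE] requires. *)
Lemma TeR_surj (g : G) v : exists zeta, v = TeR g zeta.
Proof.
exists (v *m invmx (lin1_mx (TeR g))).
rewrite -(mul_lin1_linear _ (TeR_linear g)) mulmxKV //; exact: TeR_unitmx.
Qed.

Lemma ham_field_hamiltonian : hamiltonian_field exp H ham_field.
Proof.
move=> [[[g mu] nu] xi] [[[wg wm] wn] wx].
have [zeta ->] := TeR_surj g wg.
apply: etrans (OmegaE exp_spec _ _ _ _ _ _ _ _ _ _ _ _) _.
apply: etrans (hamilton_omega (pairing_ads exp_spec) (@bracket_linearl _ _ G)
  (@bracketC _ _ G) (jacobi exp_spec) _ _ _ _ _ _ _ _ _ _ _) _.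
apply: (congr1 -%R); apply: etrans _ (esym (tmap_H H_smooth _ _ _ _ _ _ _ _)).
apply: (congr1 (fun p => p + _ + _ + _)).
exact: pairing_dual_map (TeR_linear g).
Qed.

Lemma ham_field_unique Y : hamiltonian_field exp H Y -> forall z, Y z = ham_field z.
Proof.
move=> HY z; have HX := ham_field_hamiltonian.
have E1 w : Omega exp z (Y z) w = Omega exp z (ham_field z) w.
  exact: etrans (HY z w) (esym (HX z w)).
move: E1; case: (Y z) (ham_field z) => [[[yg ym] yn] yx] [[[xg xm] xn] xx].
case: z => [[[g mu] nu] xi] E1.
have [eta etaE] := TeR_surj g yg; have [eta' etaE'] := TeR_surj g xg.
rewrite etaE etaE' in E1 *.
have [|->->->->//] := omega_inj (br := bracket G) (A := ads) (mu := mu) (nu := nu)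
  (xi := xi) (eta := eta) (eta' := eta') (pairing_ads exp_spec)
  (@bracket_linearl _ _ G) (@bracketC _ _ G) (um := ym) (un := yn) (um' := xm) (un' := xn)
  (ux := yx) (ux' := xx).
move=> zeta wm wn wx.
apply: etrans (esym (OmegaE exp_spec _ _ _ _ _ _ _ _ _ _ _ _)) _.
apply: etrans (E1 _) _.
exact: OmegaE.
Qed.

Lemma tmap_TTG_chart c (h : G) m k q (w : TM) : atlas AG c -> dom c h ->
  tmap (TTG_charted G) (vec_charted TM) (TTG_chart c) (h, m, k, q) w =
  (chart_diff (chart_at AG h) c id h w.1.1.1, w.1.1.2, w.1.2, w.2).
Proof.
move=> Ac ch; pose b := chart_at AG h.
have Ab : atlas AG b by exact: atlas_at.
have bh : dom b h by exact: dom_at.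
have [nt dt] := trans_differentiable Ab Ac bh ch.
pose Z0 : TM := (b h, m, k, q).
have d1 : is_diff Z0 (fun Z : TM => Z.1) (fun Z => Z.1) by exact: is_diff_fst.
have d2 : is_diff Z0 (fun Z : TM => Z.2) (fun Z => Z.2) by exact: is_diff_snd.
have d12 : is_diff Z0 (fun Z : TM => Z.1.2) (fun Z => Z.1.2).
  exact: is_diff_proj12.
have d111 : is_diff Z0 (fun Z : TM => Z.1.1.1) (fun Z => Z.1.1.1).
  exact: (is_diff_comp d1 (is_diff_proj11 Z0.1)).
have d112 : is_diff Z0 (fun Z : TM => Z.1.1.2) (fun Z => Z.1.1.2).
  exact: (is_diff_comp d1 (is_diff_proj12 Z0.1)).
have dc := is_diff_comp d111
  (differentiableP (dt : differentiable (c \o id \o cinv b) Z0.1.1.1)).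
have [_ dT] := is_diff_pair (is_diff_pair (is_diff_pair dc d112) d12) d2.
by have := congr1 (fun k => k w) dT.
Qed.

Lemma atlas_TTG C : atlas (TTG_charted G) C -> exists2 c, atlas AG c & C = TTG_chart c.
Proof.
move=> [C1 [C2 [c Ac [d1 -> <-]] [d2 -> <-]] [d3 -> <-]].
by exists c.
Qed.

Lemma rep_smooth c w : atlas AG c ->
  smooth_on [set Z : TM | (c @` dom c) Z.1.1.1] (fun Z => 'D_w (H_rep H c) Z).
Proof. by move=> Ac k; have [_ /(_ w)] := H_rep_smooth H_smooth Ac k.+1. Qed.

Lemma rmx_smooth c : atlas AG c -> smooth_on (c @` dom c) (rmx c).
Proof.
move=> Ac k; have oI := lie_img_open Ac; apply: Ck_mx => // i j.
rewrite (_ : (fun x => _) = fun x => rfield c x (delta_mx 0 i) 0 j); last first.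
  by apply/funext => x; rewrite mxE.
exact: (Ck_coord 0 j oI (rfield_smooth (delta_mx 0 i) Ac k)).
Qed.

(** Smoothness is invisible in [ham_field], whose group component and [delta_g] refer to preferred
    charts. Read in [c], every component is built from smooth maps by bilinear operations. *)
Lemma ham_field_rep c (h : G) m l q : atlas AG c -> dom c h ->
  let Z : TM := (c h, m, l, q) in
  tmap (TTG_charted G) (vec_charted TM) (TTG_chart c) (h, m, l, q)
    (ham_field (h, m, l, q)) =
  (rep_nu H c Z *m rmx c (c h), rep_xi H c Z + ads (rep_nu H c Z) m,
   ads (rep_mu H c Z) m - rmx c (c h) *m rep_g H c Z + ads (rep_nu H c Z) l
     - ads q (rep_xi H c Z),
   - rep_mu H c Z + bracket G (rep_nu H c Z) q).
Proof.
move=> Ac ch Z; apply: etrans (tmap_TTG_chart _ _ _ _ Ac ch) _.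
rewrite /ham_field (dual_TeR_delta_g H_smooth _ _ _ Ac ch).
rewrite (delta_mu_rep H_smooth _ _ _ Ac ch) (delta_nu_rep H_smooth _ _ _ Ac ch).
rewrite (delta_xi_rep H_smooth _ _ _ Ac ch).
apply: (congr1 (fun p => (p, _, _, _))).
apply: etrans (esym (rfield_TeR _ Ac ch)) _.
exact: esym (mul_lin1_linear _ (rfield_linear Ac ch)).
Qed.

Lemma ham_field_smooth : smooth_field (TTG_charted G) ham_field.
Proof.
move=> C /atlas_TTG[c Ac ->] k.
pose D : set TM := [set Z : TM | (c @` dom c) Z.1.1.1].
have oD : open D.
  rewrite /D (_ : mkset _ = setT `&` (fun Z : TM => Z.1.1.1) @^-1` (c @` dom c)).
    apply: open_preimage_cont; [exact: openT|exact: lie_img_open|].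
    move=> Z _; have [/differentiable_continuous + _] :=
      is_diff_comp (is_diff_fst Z) (is_diff_proj11 Z.1); exact.
  by rewrite setTI.
have C1 := Ck_fst oD (Ck_id k D); have C2 := Ck_snd oD (Ck_id k D).
have C12 := Ck_snd oD C1; have C11 := Ck_fst oD C1.
have C112 := Ck_snd oD C11; have C111 := Ck_fst oD C11.
have Crmx : Ck k D (fun Z : TM => rmx c Z.1.1.1).
  exact: (Ck_comp (finite_basis_mx _ _ _) oD (fun Z DZ => DZ) C111 (rmx_smooth Ac k)).
have Cg : Ck k D (rep_g H c).
  apply: Ck_mx => // i j.
  rewrite (_ : (fun Z => _) = fun Z => 'D_(delta_mx 0 i, 0, 0, 0) (H_rep H c) Z).
    exact: rep_smooth.
  by apply/funext => Z; rewrite mxE.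
have Cmu : Ck k D (rep_mu H c).
  apply: Ck_mx => // i j.
  rewrite (_ : (fun Z => _) = fun Z => 'D_(0, delta_mx j 0, 0, 0) (H_rep H c) Z).
    exact: rep_smooth.
  by apply/funext => Z; rewrite mxE.
have Cnu : Ck k D (rep_nu H c).
  apply: Ck_mx => // i j.
  rewrite (_ : (fun Z => _) = fun Z => 'D_(0, 0, delta_mx j 0, 0) (H_rep H c) Z).
    exact: rep_smooth.
  by apply/funext => Z; rewrite mxE.
have Cxi : Ck k D (rep_xi H c).
  apply: Ck_mx => // i j.
  rewrite (_ : (fun Z => _) = fun Z => 'D_(0, 0, 0, delta_mx 0 i) (H_rep H c) Z).
    exact: rep_smooth.
  by apply/funext => Z; rewrite mxE.
have Cads (f : TM -> E) (m : TM -> gs) :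
    Ck k D f -> Ck k D m -> Ck k D (fun Z => ads (f Z) (m Z)).
  by apply: (Ck_bilin (ads_linearl exp_spec) (ads_linearr exp_spec)) => //;
    exact: finite_basis_mx.
have Cbr (f m : TM -> E) :
    Ck k D f -> Ck k D m -> Ck k D (fun Z => bracket G (f Z) (m Z)).
  by apply: (Ck_bilin (@bracket_linearl _ _ G) (@bracket_linearr _ _ G)) => //;
    exact: finite_basis_mx.
have S1 := Ck_mulmx oD Cnu Crmx.
have S2 := Ck_add oD Cxi (Cads _ _ Cnu C112).
have S3 := Ck_add oD (Ck_add oD (Ck_add oD (Cads _ _ Cmu C112)
  (Ck_opp oD (Ck_mulmx oD Crmx Cg))) (Cads _ _ Cnu C12)) (Ck_opp oD (Cads _ _ C2 Cxi)).
have S4 := Ck_add oD (Ck_opp oD Cmu) (Cbr _ _ Cnu C2).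
have imD : TTG_chart c @` dom (TTG_chart c) = D.
  apply/seteqP; split=> [_ [[[[h m] l] q] [[[ch _] _] _] <-]|]; first by exists h.
  by move=> [[[x m] l] q] [h ch /= <-]; exists (h, m, l, q).
rewrite imD; apply: eq_Ck (Ck_pair oD (Ck_pair oD (Ck_pair oD S1 S2) S3) S4) => //.
move=> [[[x m] l] q] [h ch /= <-].
have cinvE : cinv (TTG_chart c) (c h, m, l, q) = (h, m, l, q) by rewrite /= lie_chartK.
apply: esym; apply: etrans (ham_field_rep _ _ _ Ac ch).
exact: (congr1 (fun z => tmap (TTG_charted G) (vec_charted TM) (TTG_chart c) z
  (ham_field z)) cinvE).
Qed.

End HamiltonianField.

Theorem proposition5p1 (R : realType) (n : nat) (G : lieGroup R n)
    (exp : 'rV[R]_n -> G) (exp_spec : is_lie_exp exp)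
    (H : TTG G -> R)
    (H_smooth : smooth_map (TTG_charted G) (real_charted R) H) :
  exists X : TTG G -> TTG_model R n,
    [/\ smooth_field (TTG_charted G) X,
        hamiltonian_field exp H X,
        forall Y : TTG G -> TTG_model R n,
          hamiltonian_field exp H Y -> forall z, Y z = X z,
        forall (g : G) (mu nu : 'cV[R]_n) (xi : 'rV[R]_n),
          let z : TTG G := (g, mu, nu, xi) in
          X z = right_inv_vect exp
            (delta_nu H z,
             delta_xi H z,
             ads exp (delta_mu H z) mu - dual_map (TeR g) (delta_g H z),
             - delta_mu H z) z
      & forall (g : R -> G) (mu nu : R -> 'cV[R]_n) (xi : R -> 'rV[R]_n) (t : R),
          let z (s : R) : TTG G := (g s, mu s, nu s, xi s) in
          has_velocity (TTG_charted G) z t (X (z t)) <->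
          [/\ has_velocity (lie_charted G) g t (TeR (g t) (delta_nu H (z t))),
              is_derive t (1 : R) mu
                (delta_xi H (z t) + ads exp (delta_nu H (z t)) (mu t)),
              is_derive t (1 : R) nu
                (ads exp (delta_mu H (z t)) (mu t)
                 + ads exp (delta_nu H (z t)) (nu t)
                 - dual_map (TeR (g t)) (delta_g H (z t))
                 - ads exp (xi t) (delta_xi H (z t)))
            & is_derive t (1 : R) xi
                (- delta_mu H (z t) + ad exp (delta_nu H (z t)) (xi t))]].
Proof.
exists (ham_field exp H); split.
- exact: ham_field_smooth.
- exact: ham_field_hamiltonian.
- exact: ham_field_unique.
- move=> g mu nu xi z.
  (* Both sides agree by conversion except for [bracket] against [ad] in the last component. *)
  exact: (congr1 (fun b => (_, _, _, - delta_mu H z + b))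
    (esym (ad_bracket exp_spec _ _))).
move=> g mu nu xi t z.
(* The nu-equation lists two summands in the opposite order to [ham_field]. *)
rewrite (ad_bracket exp_spec) -(addrAC (ads exp (delta_mu H (z t)) (mu t))).
split.
  move=> /has_velocity_prod[/has_velocity_prod[/has_velocity_prod[vg vm] vn] vx].
  split; [exact: vg| | |]; exact/has_velocity_vec.
move=> [vg vm vn vx].
apply/has_velocity_prod; split; last exact/has_velocity_vec.
apply/has_velocity_prod; split; last exact/has_velocity_vec.
by apply/has_velocity_prod; split; last exact/has_velocity_vec.
Qed.
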